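(* Let $\mathcal{A}=\{\mathcal{A}_s\}_{s\in S}$ be a saturated semi-abelian Fell bundle over an inverse semigroup $S$, let $\mathcal{G}$ be the associated étale groupoid of germs, and let $L$ be the associated continuous Banach bundle over $\mathcal{G}$ of classes $[a,s,x]$. With the multiplication $[a,s,x]\cdot[b,t,y]=[ab,st,y]$ (defined when $\theta_t(y)=x$) and the involution $[a,s,x]^*=[a^*,s^*,\theta_s(x)]$, $L$ is a Fell line bundle, that is, a one-dimensional, locally trivial (continuous) Fell bundle over the étale groupoid $\mathcal{G}$.
   Context: Fell bundles over inverse semigroups: for an inverse semigroup $S$, $E(S)$ is its set of idempotents and $s\le t$ means $s=ts^*s$. A Fell bundle over $S$ is a family $\mathcal{A}=\{\mathcal{A}_s\}_{s\in S}$ of complex Banach spaces (also viewed as their disjoint union) with a multiplication $\mathcal{A}\times\mathcal{A}\to\mathcal{A}$, an involution $^*$, and linear maps $j_{t,s}\colon\mathcal{A}_s\to\mathcal{A}_t$ for $s\le t$, such that: $\mathcal{A}_s\mathcal{A}_t\subseteq\mathcal{A}_{st}$, bilinearly; the product is associative; $\|ab\|\le\|a\|\|b\|$; $\mathcal{A}_s^*\subseteq\mathcal{A}_{s^*}$, conjugate-linearly; $(a^* )^*=a$, $\|a^*\|=\|a\|$, $(ab)^*=b^*a^*$; $\|a^*a\|=\|a\|^2$ and $a^*a$ is positive in the $C^*$-algebra $\mathcal{A}_{s^*s}$ for $a\in\mathcal{A}_s$; each $j_{t,s}$ is isometric; $j_{t,r}=j_{t,s}j_{s,r}$ for $r\le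 s\le t$; $j_{t,s}(a)j_{v,u}(b)=j_{tv,su}(ab)$ for $s\le t$, $u\le v$; $j_{t,s}(a)^*=j_{t^*,s^*}(a^* )$. It is saturated if $\mathcal{A}_s\mathcal{A}_t$ spans a dense subspace of $\mathcal{A}_{st}$ for all $s,t$, and semi-abelian if $\mathcal{A}_e$ is commutative for all $e\in E(S)$. $C^*$-algebras: $C^*(\mathcal{A})$ is the enveloping $C^*$-algebra of the $*$-algebra of finite formal sums $\sum a_s\delta_s$ ($a_s\in\mathcal{A}_s$; $(a\delta_s)(b\delta_t)=(ab)\delta_{st}$, $(a\delta_s)^*=a^*\delta_{s^*}$) modulo the ideal spanned by all $a\delta_s-j_{t,s}(a)\delta_t$, $s\le t$. $\mathcal{E}$ is the restriction of $\mathcal{A}$ to $E(S)$. It is known that the fibers $\mathcal{A}_s$ and $C^*(\mathcal{E})$ embed canonically in $C^*(\mathcal{A})$ and that each $\mathcal{A}_e$, $e\in E(S)$, is a closed ideal of $C^*(\mathcal{E})$; these are treated as inclusions. The action: let $\mathcal{A}$ be saturated and semi-abelian. Then $C^*(\mathcal{E})$ is commutative; let $X$ be its spectrum, so $C^*(\mathcal{E})=C_0(X)$, and for $e\in E(S)$ let $\mathcal{U}_e\subseteq X$ be the open set with $\mathcal{A}_e=C_0(\mathcal{U}_e)$. For $a\in\mathcal{A}$ put $\mathrm{dom}(a)=\{x\in X:(a^*a)(x)>0\}$; there is a unique homeomorphism $\theta_a\colon\mathrm{dom}(a)\to\mathrm{dom}(a^* )$ with $(a^*ba)(x)=(a^*a)(x)b(\theta_a(x))$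 for all $x\in\mathrm{dom}(a)$, $b\in C_0(X)$. For $s\in S$, $\theta_s\colon\mathcal{U}_{s^*s}\to\mathcal{U}_{ss^*}$ is the homeomorphism with $\theta_s|_{\mathrm{dom}(a)}=\theta_a$ for all $a\in\mathcal{A}_s$; $\theta$ is an action of $S$ on $X$. Groupoid of germs: $\mathcal{G}=\{[s,x]:s\in S,x\in\mathcal{U}_{s^*s}\}$, where $[s,x]=[t,y]$ iff $x=y$ and there is $e\in E(S)$ with $x\in\mathcal{U}_e$ and $se=te$; source $\mathrm{d}([s,x])=x$, range $\mathrm{r}([s,x])=\theta_s(x)$, product $[s,x][t,y]=[st,y]$ if $\theta_t(y)=x$, inverse $[s,x]^{-1}=[s^*,\theta_s(x)]$, topology generated by the sets $\mathcal{O}(s,U)=\{[s,x]:x\in U\}$, $U\subseteq\mathcal{U}_{s^*s}$ open; $\mathcal{O}_s=\mathcal{O}(s,\mathcal{U}_{s^*s})$. The unit space is identified with $X$ via $x\mapsto[e,x]$ for any $e\in E(S)$ with $x\in\mathcal{U}_e$. This is an étale groupoid (unit space locally compact Hausdorff, range and source local homeomorphisms; not necessarily Hausdorff). The bundle $L$: for $a,b\in\mathcal{A}_s$, $x\in X$, write $a\overset{x}{=}b$ if $((a-b)^*(a-b))(x)=0$. On triples $(a,s,x)$ with $a\in\mathcal{A}_s$, $x\in\mathcal{U}_{s^*s}$, let $(a,s,x)\sim(a',s',x')$ iff $x=x'$ and there are $e\in E(S)$, $b\in\mathcal{A}_e$ with $b(x)\ne0$, $se=s'e$, $ab\overset{x}{=}a'b$.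 $[a,s,x]$ is the class, $L$ the set of classes, with projection $[a,s,x]\mapsto[s,x]$. Fibers have vector space structure $\lambda[a,s,x]=[\lambda a,s,x]$, $[a,s,x]+[b,t,x]=[ac+bc,se,x]$ where $e\in E(S)$, $se=te$, $x\in\mathcal{U}_e$, $c\in\mathcal{A}_e$, $c(x)=1$, and norm $\|[a,s,x]\|=\sqrt{(a^*a)(x)}$. $L$ has the unique topology making it a continuous Banach bundle for which all local sections $\hat a\colon\mathcal{O}_s\to L$, $\hat a([s,x])=[a,s,x]$ ($a\in\mathcal{A}_s$), are continuous. The multiplication and involution in the claim are well-defined on classes. Banach bundles: an upper-semicontinuous (usc) Banach bundle over a space $Y$ is a continuous open surjection $p\colon B\to Y$ with complex Banach space fibers such that the norm is usc, addition is continuous on $\{(v,w):p(v)=p(w)\}$, each $v\mapsto\lambda v$ is continuous, and any net with $p(v_i)\to y$, $\|v_i\|\to0$ converges to $0_y$; it is a continuous Banach bundle if the norm is continuous. Fell bundle over an étale groupoid $\mathcal{G}$: a usc Banach bundle $p\colon\mathcal{B}\to\mathcal{G}$ with a continuous associative multiplication on $\{(a,b):(p(a),p(b))\in\mathcal{G}^{(2)}\}$ restricting to bilinear maps $\mathcal{B}_{\gamma_1}\times\mathcal{B}_{\gamma_2}\to\mathcal{B}_{\gamma_1\gamma_2}$, and a continuous involution restricting to conjugate-linear maps $\mathcal{B}_\gamma\to\mathcal{B}_{\gamma^{-1}}$, such that $\|ab\|\le\|a\|\|b\|$, $(a^* )^*=a$, $\|a^*\|=\|a\|$, $(ab)^*=b^*a^*$,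 $\|a^*a\|=\|a\|^2$, and $a^*a$ is positive in the $C^*$-algebra $\mathcal{B}_{\mathrm{d}(\gamma)}$ for $a\in\mathcal{B}_\gamma$. *)

(* Defs.v *)
From HB Require Import structures.
From mathcomp Require Import all_boot all_order all_algebra.
From mathcomp Require Import complex.
From mathcomp Require Import all_classical all_reals all_analysis.
Set Implicit Arguments.
Unset Strict Implicit.
Unset Printing Implicit Defensive.
Import Order.TTheory GRing.Theory Num.Theory numFieldNormedType.Exports.
Local Open Scope classical_set_scope.
Local Open Scope ring_scope.

HB.mixin Record Semigroup_isInverse S of Semigroup S := {
  istar : S -> S;
  mul_star_mul : forall s : S, (s * istar s * s)%g = s;
  star_mul_star : forall s : S, (istar s * s * istar s)%g = istar s;
  istar_uniq : forall s t : S,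
    (s * t * s)%g = s -> (t * s * t)%g = t -> t = istar s }.

#[short(type="invSemigroupType")]
HB.structure Definition InvSemigroup := {S of Semigroup_isInverse S & Semigroup S}.

Notation "s ^*" := (istar s) : group_scope.

(* The natural partial order. *)
Definition invle (S : invSemigroupType) (s t : S) : bool :=
  s == (t * s^* * s)%g.

Definition idem (S : invSemigroupType) : Type := {e : S | (e * e)%g == e}.
HB.instance Definition _ (S : invSemigroupType) := SubChoice.on (idem S).

Section Idempotents.
Variable S : invSemigroupType.
Implicit Types (s t : S) (e f : idem S).
Local Open Scope group_scope.

Lemma istar_inv s t : s * t * s = s -> t * s * t = t -> t = s^*.
Proof. exact: istar_uniq. Qed.

Lemma idemP e : val e * val e = val e. Proof. exact/eqP/(valP e). Qed.

Lemma istar_idem s : s * s = s -> s^* = s.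
Proof. by move=> ss; apply/esym/istar_inv; rewrite !ss. Qed.

Lemma mul_idem_aux s t : s * s = s -> t * t = t -> (s * t) * (s * t) = s * t.
Proof.
move=> ss tt; set z := (s * t)^*.
have K1 : s * t * z * s * t = s * t by rewrite -mulgA mul_star_mul.
have K2 : z * s * t * z = z by rewrite -[z * s * t]mulgA star_mul_star.
have zE : t * z * s = z.
  apply: istar_inv; rewrite !mulgA.
    by rewrite -(mulgA s t t) tt -(mulgA _ s s) ss.
  rewrite -(mulgA _ s s) ss -(mulgA _ t t) tt.
  by rewrite -{3}K2 !mulgA.
have zz : z * z = z.
  have -> : z * z = t * (z * s * t * z) * s by rewrite -{1 2}zE !mulgA.
  by rewrite K2.
have : s * t = z^*.
  by apply: istar_inv; [exact: star_mul_star | exact: mul_star_mul].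
by rewrite (istar_idem zz) => ->.
Qed.

Lemma idem_mulP e f : (val e * val f) * (val e * val f) == val e * val f.
Proof. by apply/eqP/mul_idem_aux; apply: idemP. Qed.

Lemma idem_starP e : (val e)^* * (val e)^* == (val e)^*.
Proof. by rewrite (istar_idem (idemP e)) idemP. Qed.

Lemma idem_srcP s : (s^* * s) * (s^* * s) == s^* * s.
Proof. by rewrite mulgA star_mul_star. Qed.

Definition idem_mul e f : idem S := exist (fun s : S => s * s == s) _ (idem_mulP e f).
Definition idem_star e : idem S := exist (fun s : S => s * s == s) _ (idem_starP e).
(* The idempotent s^* s. *)
Definition src s : idem S := exist (fun s : S => s * s == s) _ (idem_srcP s).

Lemma idem_mulA : associative idem_mul.
Proof. by move=> e f g; apply: val_inj; apply: mulgA. Qed.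

HB.instance Definition _ := isSemigroup.Build (idem S) idem_mulA.

Lemma idem_mul_star_mul e : e * idem_star e * e = e.
Proof. exact/val_inj/mul_star_mul. Qed.
Lemma idem_star_mul_star e : idem_star e * e * idem_star e = idem_star e.
Proof. exact/val_inj/star_mul_star. Qed.
Lemma idem_star_uniq e f : e * f * e = e -> f * e * f = f -> f = idem_star e.
Proof.
move=> /(congr1 val) h /(congr1 val) k; apply: val_inj; exact: istar_inv.
Qed.
HB.instance Definition _ := Semigroup_isInverse.Build (idem S)
  idem_mul_star_mul idem_star_mul_star idem_star_uniq.
End Idempotents.

Record cstarAlg (R : realType) := CstarAlg {
  cs_sort :> completeNormedModType R[i];
  cs_mul : cs_sort -> cs_sort -> cs_sort;
  cs_star : cs_sort -> cs_sort;
  cs_mulA : associative cs_mul;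
  cs_mul_linl : forall b, linear (fun a => cs_mul a b);
  cs_mul_linr : forall a, linear (cs_mul a);
  cs_norm_mul : forall a b, `|cs_mul a b| <= `|a| * `|b|;
  cs_star_lin : forall (k : R[i]) a b,
    cs_star (k *: a + b) = k^* *: cs_star a + cs_star b;
  cs_starK : involutive cs_star;
  cs_star_mul : forall a b, cs_star (cs_mul a b) = cs_mul (cs_star b) (cs_star a);
  cs_cstar : forall a, `|cs_mul (cs_star a) a| = `|a| ^+ 2 }.

(* Equations whose two sides lie in fibers with propositionally equal indices
   are stated in the disjoint union {s & A s}. An element of the C*-algebra A_e
   is positive when it has the form b^* b with b in A_e. *)
Record fellBundle (R : realType) (S : invSemigroupType) := FellBundle {
  fb :> S -> completeNormedModType R[i];
  fb_mul : forall s t, fb s -> fb t -> fb (s * t)%g;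
  fb_star : forall s, fb s -> fb (s^*)%g;
  fb_j : forall s t, invle s t -> {linear fb s -> fb t};
  fb_mul_linl : forall s t (b : fb t), linear (fun a : fb s => fb_mul a b);
  fb_mul_linr : forall s t (a : fb s), linear (fun b : fb t => fb_mul a b);
  fb_mulA : forall s t u (a : fb s) (b : fb t) (c : fb u),
    Tagged fb (fb_mul a (fb_mul b c)) = Tagged fb (fb_mul (fb_mul a b) c);
  fb_norm_mul : forall s t (a : fb s) (b : fb t),
    `|fb_mul a b| <= `|a| * `|b|;
  fb_star_lin : forall s (k : R[i]) (a b : fb s),
    fb_star (k *: a + b) = k^* *: fb_star a + fb_star b;
  fb_starK : forall s (a : fb s), Tagged fb (fb_star (fb_star a)) = Tagged fb a;
  fb_norm_star : forall s (a : fb s), `|fb_star a| = `|a|;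
  fb_star_mul : forall s t (a : fb s) (b : fb t),
    Tagged fb (fb_star (fb_mul a b)) = Tagged fb (fb_mul (fb_star b) (fb_star a));
  fb_cstar : forall s (a : fb s), `|fb_mul (fb_star a) a| = `|a| ^+ 2;
  fb_pos : forall s (a : fb s), exists b : fb (s^* * s)%g,
    Tagged fb (fb_mul (fb_star a) a) = Tagged fb (fb_mul (fb_star b) b);
  fb_j_isom : forall s t (st : invle s t) (a : fb s), `|fb_j st a| = `|a|;
  fb_j_comp : forall r s t (rs : invle r s) (st : invle s t) (rt : invle r t)
    (a : fb r), fb_j rt a = fb_j st (fb_j rs a);
  fb_j_mul : forall s t u v (st : invle s t) (uv : invle u v)
    (h : invle (s * u)%g (t * v)%g) (a : fb s) (b : fb u),
    fb_mul (fb_j st a) (fb_j uv b) = fb_j h (fb_mul a b);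
  fb_j_star : forall s t (st : invle s t) (h : invle (s^*)%g (t^*)%g) (a : fb s),
    fb_star (fb_j st a) = fb_j h (fb_star a) }.

Definition saturated (R : realType) (S : invSemigroupType) (A : fellBundle R S) :=
  forall s t, dense [set c : A (s * t)%g |
    exists l : seq (A s * A t), c = \sum_(p <- l) fb_mul p.1 p.2].

Definition semi_abelian (R : realType) (S : invSemigroupType) (A : fellBundle R S) :=
  forall (e : idem S) (a b : A (val e)), fb_mul a b = fb_mul b a.

Section Restriction.
Variables (R : realType) (S : invSemigroupType) (A : fellBundle R S).

Lemma Tagged_val (e f : idem S) (a : A (val e)) (b : A (val f)) :
  Tagged (fb A) a = Tagged (fb A) b ->
  Tagged (fun e : idem S => fb A (val e)) a = Tagged (fun e : idem S => fb A (val e)) b.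
Proof.
move=> ab; have ef : e = f by apply/val_inj/(congr1 tag ab).
by case: _ / ef b ab => b ab; congr (Tagged _ _); exact: eq_from_Tagged ab.
Qed.

Definition restr : fellBundle R (idem S) := @FellBundle R (idem S)
  (fun e => A (val e))
  (fun e f a b => fb_mul a b)
  (fun e a => fb_star a)
  (fun e f ef => @fb_j R S A (val e) (val f) ef)
  (fun e f => @fb_mul_linl R S A (val e) (val f))
  (fun e f => @fb_mul_linr R S A (val e) (val f))
  (fun e f g a b c => @Tagged_val (e * (f * g))%g (e * f * g)%g _ _ (fb_mulA a b c))
  (fun e f => @fb_norm_mul R S A (val e) (val f))
  (fun e => @fb_star_lin R S A (val e))
  (fun e a => @Tagged_val (e^*^*)%g e _ _ (fb_starK a))
  (fun e => @fb_norm_star R S A (val e))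
  (fun e f a b => @Tagged_val (e * f)^*%g (f^* * e^*)%g _ _ (fb_star_mul a b))
  (fun e => @fb_cstar R S A (val e))
  (fun e a => let: ex_intro b hb := fb_pos a in
    ex_intro _ b (@Tagged_val (e^* * e)%g ((e^* * e)^* * (e^* * e))%g _ _ hb))
  (fun e f ef => @fb_j_isom R S A (val e) (val f) ef)
  (fun e f g => @fb_j_comp R S A (val e) (val f) (val g))
  (fun e f g h => @fb_j_mul R S A (val e) (val f) (val g) (val h))
  (fun e f => @fb_j_star R S A (val e) (val f)).
End Restriction.

(* The *-algebra of finite formal sums modulo the ideal is presented as a setoid:
   a list [:: (s1; a1); ...; (sn; an)] stands for a1 delta_s1 + ... + an delta_sn. *)
Section FormalSums.
Variables (R : realType) (S : invSemigroupType) (A : fellBundle R S).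

Definition fsum : Type := seq {s : S & fb A s}.

Definition delta (s : S) (a : A s) : {s : S & fb A s} := Tagged (fb A) a.

Definition fs_mul (x y : fsum) : fsum :=
  [seq delta (fb_mul (tagged u) (tagged v)) |
    u : {s : S & fb A s} <- x, v : {s : S & fb A s} <- y].
Definition fs_star (x : fsum) : fsum :=
  [seq delta (fb_star (tagged u)) | u : {s : S & fb A s} <- x].
Definition fs_scale (k : R[i]) (x : fsum) : fsum :=
  [seq delta (k *: tagged u) | u : {s : S & fb A s} <- x].

Definition fs_coef (x : fsum) (s : S) : A s :=
  \sum_(u <- x) untag 0 (fun a : A s => a) u.

Inductive fs_ideal : fsum -> Prop :=
| fs_ideal_nil : fs_ideal [::]
| fs_ideal_cons s t (st : invle s t) (a : A s) x :
    fs_ideal x -> fs_ideal [:: delta a, delta (- fb_j A st a) & x].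

Definition fs_eq (x y : fsum) : Prop :=
  exists2 k, fs_ideal k & forall s, fs_coef x s = fs_coef (y ++ k) s.

Record fs_star_hom (D : cstarAlg R) (phi : fsum -> D) : Prop := {
  fs_hom_eq : forall x y, fs_eq x y -> phi x = phi y;
  fs_hom_add : forall x y, phi (x ++ y) = phi x + phi y;
  fs_hom_scale : forall k x, phi (fs_scale k x) = k *: phi x;
  fs_hom_mul : forall x y, phi (fs_mul x y) = cs_mul (phi x) (phi y);
  fs_hom_star : forall x, phi (fs_star x) = cs_star (phi x) }.

(* C is the Hausdorff completion of the *-algebra for its largest C*-seminorm. *)
Definition enveloping (C : cstarAlg R) (i : fsum -> C) : Prop :=
  [/\ fs_star_hom i, dense (range i) &
      forall (D : cstarAlg R) (phi : fsum -> D), fs_star_hom phi ->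
        forall x, `|phi x| <= `|i x|].
End FormalSums.

(* CA = C^*(A), CE = C^*(E), and the canonical embedding of CE into CA. *)
Record envelopes (R : realType) (S : invSemigroupType) (A : fellBundle R S) :=
  Envelopes {
  CA : cstarAlg R;
  CE : cstarAlg R;
  iA : fsum A -> CA;
  iE : fsum (restr A) -> CE;
  iA_env : enveloping iA;
  iE_env : enveloping iE;
  incl : CE -> CA;
  incl_linear : linear incl;
  incl_mul : {morph incl : a b / cs_mul a b};
  incl_star : {morph incl : a / cs_star a};
  incl_norm : forall a, `|incl a| = `|a|;
  incl_iE : forall x : fsum (restr A),
    incl (iE x) = iA [seq delta (tagged u : A (val (tag u))) | u <- x] }.

(* Continuity of a *-homomorphism between C*-algebras is automatic. *)
Record is_character (R : realType) (C : cstarAlg R) (chi : C -> R[i]^o) : Prop := {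
  char_linear : linear chi;
  char_mul : {morph chi : a b / cs_mul a b >-> a * b};
  char_star : forall a, chi (cs_star a) = (chi a)^*;
  char_continuous : continuous chi;
  char_neq0 : exists a, chi a != 0 }.

(* The weak-* topology. *)
Definition spectrum (R : realType) (C : cstarAlg R) : Type :=
  [set chi : {ptws C -> R[i]^o} | is_character chi].
HB.instance Definition _ (R : realType) (C : cstarAlg R) :=
  Topological.copy (spectrum C)
    [set chi : {ptws C -> R[i]^o} | is_character chi].

(* Arrows of type G, units of type X; the product g h is meaningful only when
   the source of g is the range of h. *)
Record groupoid (G X : Type) := Groupoid {
  g_src : G -> X;
  g_rng : G -> X;
  g_unit : X -> G;
  g_mul : G -> G -> G;
  g_inv : G -> G }.

Definition composable (G X : Type) (K : groupoid G X) (g h : G) : Prop :=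
  g_src K g = g_rng K h.

Record is_groupoid (G X : Type) (K : groupoid G X) : Prop := {
  g_src_unit : cancel (g_unit K) (g_src K);
  g_rng_unit : cancel (g_unit K) (g_rng K);
  g_src_mul : forall g h, composable K g h -> g_src K (g_mul K g h) = g_src K h;
  g_rng_mul : forall g h, composable K g h -> g_rng K (g_mul K g h) = g_rng K g;
  g_mulA : forall g h k, composable K g h -> composable K h k ->
    g_mul K g (g_mul K h k) = g_mul K (g_mul K g h) k;
  g_mul1 : forall g, g_mul K g (g_unit K (g_src K g)) = g;
  g_1mul : forall g, g_mul K (g_unit K (g_rng K g)) g = g;
  g_src_inv : forall g, g_src K (g_inv K g) = g_rng K g;
  g_rng_inv : forall g, g_rng K (g_inv K g) = g_src K g;
  g_mulV : forall g, g_mul K g (g_inv K g) = g_unit K (g_rng K g);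
  g_mulVr : forall g, g_mul K (g_inv K g) g = g_unit K (g_src K g) }.

Definition local_homeomorphism (Y Z : topologicalType) (f : Y -> Z) : Prop :=
  forall y, exists O : set Y, [/\ open O, O y, {in O &, injective f},
    {within O, continuous f} & forall V, open V -> V `<=` O -> open (f @` V)].

(* Continuity of g_unit, together with that of g_src, makes X homeomorphic to
   the unit space as a subspace of G. *)
Record is_etale_groupoid (G X : topologicalType) (K : groupoid G X) : Prop := {
  etale_groupoid : is_groupoid K;
  etale_hausdorff : hausdorff_space X;
  etale_locally_compact : locally_compact [set: X];
  etale_unit : continuous (g_unit K);
  etale_mul : {within [set p : G * G | composable K p.1 p.2],
    continuous (fun p => g_mul K p.1 p.2)};
  etale_inv : continuous (g_inv K);
  etale_src : local_homeomorphism (g_src K);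
  etale_rng : local_homeomorphism (g_rng K) }.

(* bb_add v w is meaningful only when v and w lie in the same fiber. *)
Record bundle (R : realType) (B Y : Type) := Bundle {
  bb_proj : B -> Y;
  bb_add : B -> B -> B;
  bb_scale : R[i] -> B -> B;
  bb_zero : Y -> B;
  bb_norm : B -> R }.

Section Bundles.
Variables (R : realType) (B Y : topologicalType) (D : bundle R B Y).

(* phi identifies V with the fiber over y. *)
Record is_fiber (y : Y) (V : completeNormedModType R[i]) (phi : V -> B) : Prop := {
  fiber_proj : forall v, bb_proj D (phi v) = y;
  fiber_inj : injective phi;
  fiber_surj : forall b, bb_proj D b = y -> exists v, phi v = b;
  fiber_add : forall u v, phi (u + v) = bb_add D (phi u) (phi v);
  fiber_scale : forall k v, phi (k *: v) = bb_scale D k (phi v);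
  fiber_zero : phi 0 = bb_zero D y;
  fiber_norm : forall v, (bb_norm D (phi v))%:C%C = `|v| }.

(* Nets are replaced by filters in the last condition. *)
Record is_usc_banach_bundle : Prop := {
  bb_proj_continuous : continuous (bb_proj D);
  bb_proj_open : forall O, open O -> open (bb_proj D @` O);
  bb_proj_surj : forall y, exists b, bb_proj D b = y;
  bb_fiber : forall y, exists (V : completeNormedModType R[i]) (phi : V -> B),
    is_fiber y phi;
  bb_norm_usc : forall r : R, open [set b | bb_norm D b < r];
  bb_add_continuous : {within [set p : B * B | bb_proj D p.1 = bb_proj D p.2],
    continuous (fun p => bb_add D p.1 p.2)};
  bb_scale_continuous : forall k, continuous (bb_scale D k);
  bb_cvg_zero : forall (F : set_system B) y, ProperFilter F ->
    bb_proj D @ F --> y -> bb_norm D @ F --> (0 : R) -> F --> bb_zero D y }.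

Record is_continuous_banach_bundle : Prop := {
  cbb_usc : is_usc_banach_bundle;
  cbb_norm : continuous (bb_norm D) }.

Definition one_dimensional : Prop := forall y, exists b,
  [/\ bb_proj D b = y, b <> bb_zero D y &
      forall c, bb_proj D c = y -> exists k, c = bb_scale D k b].

(* A fiberwise linear homeomorphism phi of O x C onto the part of B over O, its
   inverse being b |-> (bb_proj D b, psi b). *)
Definition locally_trivial : Prop := forall y, exists O : set Y, [/\ open O, O y &
  exists (phi : Y * R[i]^o -> B) (psi : B -> R[i]^o),
  [/\ forall z k, O z -> bb_proj D (phi (z, k)) = z,
      forall z k c d, O z ->
        phi (z, k * c + d) = bb_add D (bb_scale D k (phi (z, c))) (phi (z, d)),
      (forall z k, O z -> psi (phi (z, k)) = k) /\
      (forall b, O (bb_proj D b) -> phi (bb_proj D b, psi b) = b),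
      {within O `*` setT, continuous phi} &
      {within bb_proj D @^-1` O, continuous psi}]].
End Bundles.

Section FellBundles.
Variables (R : realType) (G X B : topologicalType).
Variables (K : groupoid G X) (D : bundle R B G).
Variables (mul : B -> B -> B) (star : B -> B).
Local Notation p := (bb_proj D).
Local Notation comp a b := (composable K (p a) (p b)).
Local Notation sc := (bb_scale D).
Local Notation ad := (bb_add D).
Local Notation N := (bb_norm D).

(* Positivity in the C*-algebra over a unit is again taken to mean being of the
   form c^* c. *)
Record is_fell_bundle : Prop := {
  fell_etale : is_etale_groupoid K;
  fell_bundle_usc : is_usc_banach_bundle D;
  fell_mul_proj : forall a b, comp a b -> p (mul a b) = g_mul K (p a) (p b);
  fell_mul_continuous : {within [set u : B * B | comp u.1 u.2],
    continuous (fun u => mul u.1 u.2)};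
  fell_mulA : forall a b c, comp a b -> comp b c ->
    mul a (mul b c) = mul (mul a b) c;
  fell_mul_linl : forall k a b c, p a = p b -> comp a c ->
    mul (ad (sc k a) b) c = ad (sc k (mul a c)) (mul b c);
  fell_mul_linr : forall k a b c, comp a b -> p b = p c ->
    mul a (ad (sc k b) c) = ad (sc k (mul a b)) (mul a c);
  fell_star_proj : forall a, p (star a) = g_inv K (p a);
  fell_star_continuous : continuous star;
  fell_star_lin : forall k a b, p a = p b ->
    star (ad (sc k a) b) = ad (sc k^* (star a)) (star b);
  fell_norm_mul : forall a b, comp a b -> N (mul a b) <= N a * N b;
  fell_starK : involutive star;
  fell_norm_star : forall a, N (star a) = N a;
  fell_star_mul : forall a b, comp a b -> star (mul a b) = mul (star b) (star a);
  fell_cstar : forall a, N (mul (star a) a) = N a ^+ 2;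
  fell_pos : forall a, exists c,
    p c = g_unit K (g_src K (p a)) /\ mul (star a) a = mul (star c) c }.

Record is_fell_line_bundle : Prop := {
  fell_line_fell : is_fell_bundle;
  fell_line_continuous : is_continuous_banach_bundle D;
  fell_line_dim : one_dimensional D;
  fell_line_trivial : locally_trivial D }.
End FellBundles.

Section Germs.
Variables (R : realType) (S : invSemigroupType) (A : fellBundle R S).
Variable W : envelopes A.
Local Notation X := (spectrum (CE W)).

(* The value a(x) for a in A_e. *)
Definition ev (x : X) (e : idem S) (a : A (val e)) : R[i] :=
  val x (iE W [:: @delta R _ (restr A) e a]).

(* The open set with A_e = C_0(U_e). *)
Definition Uopen (e : idem S) : set X := [set x | exists a : A (val e), ev x a != 0].

(* (a^* a)(x) *)
Definition sq (x : X) (s : S) (a : A s) : R[i] :=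
  @ev x (src s) (fb_mul (fb_star a) a).

Definition dom (s : S) (a : A s) : set X := [set x | 0 < sq x a].

(* c = a^* b a, computed in C^*(A). *)
Definition sandwich (s : S) (a : A s) (b c : CE W) : Prop :=
  incl c = cs_mul (cs_mul (cs_star (iA W [:: delta a])) (incl b)) (iA W [:: delta a]).

(* theta_s(x) is the common value theta_a(x), for a in A_s with x in dom(a); the
   formula defining theta_a determines it pointwise. The value is meaningless if x
   is not in U_(s^* s). *)
Definition theta (s : S) (x : X) : X :=
  xget x [set y : X | forall a : A s, dom a x ->
    forall b c : CE W, sandwich a b c -> val x c = sq x a * val y b].

Definition germ_class (s : S) (x : X) : set (S * X) :=
  [set q | Uopen (src q.1) q.2 /\ x = q.2 /\
    exists2 e : idem S, Uopen e x & (s * val e = q.1 * val e)%g].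

Definition germ : Type :=
  {g : set (S * X) | exists p, Uopen (src p.1) p.2 /\ g = germ_class p.1 p.2}.
HB.instance Definition _ := gen_eqMixin germ.
HB.instance Definition _ := gen_choiceMixin germ.

Definition mk_germ (s : S) (x : X) (h : Uopen (src s) x) : germ :=
  exist _ (germ_class s x) (ex_intro _ (s, x) (conj h erefl)).

(* g = [s, x] *)
Definition is_germ (g : germ) (s : S) (x : X) : Prop :=
  Uopen (src s) x /\ sval g = germ_class s x.

Definition germ_rep (g : germ) : S * X := projT1 (cid (svalP g)).

(* O(s, V) *)
Definition germ_open (s : S) (V : set X) : set germ :=
  [set g | exists2 x, V x & is_germ g s x].

HB.instance Definition _ := isSubBaseTopological.Build germ
  [set O | exists s V, [/\ open V, V `<=` Uopen (src s) & O = germ_open s V]] id.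

Lemma Uopen_cover (x : X) : exists e, Uopen e x.
Proof.
apply: contrapT => noU; have ev0 e a : @ev x e a = 0.
  by apply/eqP/negP => /negP ne0; apply: noU; exists e, a.
have [ihom idense _] := iE_env W.
have [chil _ _ chic [c chic0]] : is_character (val x) := set_mem (valP x).
have chi0 : val x 0 = 0.
  by have := chil (-1) 0 0; rewrite scaler0 addr0 scaleN1r addNr.
have iE0 u : val x (iE W u) = 0.
  elim: u => [|[e a] u IH].
    rewrite (_ : [::] = fs_scale 0 [::] :> fsum (restr A))//.
    by rewrite (fs_hom_scale ihom) scale0r.
  rewrite -cat1s (fs_hom_add ihom) -[X in X + _]scale1r chil IH scale1r addr0.
  exact: ev0.
have : (val x @^-1` [set~ 0]) `&` range (iE W) !=set0.
  apply: idense; first by exists c => /=; apply/eqP.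
  apply: open_comp; first by move=> y _; exact: chic.
  exact/closed_openC/accessible_closed_set1/hausdorff_accessible/norm_hausdorff.
by move=> [y [y0 [u _ uy]]]; apply: y0; rewrite -uy; exact: iE0.
Qed.

Lemma Uopen_src (e : idem S) x : Uopen e x -> Uopen (src (val e)) x.
Proof.
by rewrite (_ : src (val e) = e)//; apply: val_inj; rewrite /= istar_idem idemP.
Qed.

Definition germ_src (g : germ) : X := (germ_rep g).2.

Definition germ_rng (g : germ) : X := theta (germ_rep g).1 (germ_rep g).2.

Definition germ_unit (x : X) : germ :=
  let: exist e h := cid (Uopen_cover x) in
  @mk_germ (val e) x (Uopen_src h).

Definition germ_mul (g h : germ) : germ :=
  xget g [set k | exists s x t y, [/\ is_germ g s x, is_germ h t y,
    theta t y = x & is_germ k (s * t)%g y]].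

Definition germ_inv (g : germ) : germ :=
  xget g [set k | exists s x, is_germ g s x /\ is_germ k (s^*)%g (theta s x)].

Definition germ_groupoid : groupoid germ X :=
  Groupoid germ_src germ_rng germ_unit germ_mul germ_inv.

(* Elements u and v of a common fiber A_s with u = v at x. *)
Definition eq_at (x : X) (u v : {s : S & fb A s}) : Prop :=
  exists s (a b : A s), [/\ u = delta a, v = delta b & sq x (a - b) = 0].

Definition triple : Type := {s : S & (fb A s * X)%type}.

(* The equality se = s'e is part of eq_at. *)
Definition line_class (s : S) (a : A s) (x : X) : set triple :=
  [set q : triple | Uopen (src (tag q)) (tagged q).2 /\ x = (tagged q).2 /\
    exists (e : idem S) (b : A (val e)), ev x b != 0 /\
      eq_at x (delta (fb_mul a b)) (delta (fb_mul (tagged q).1 b))].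

Definition line : Type :=
  {c : set triple | exists q : triple, Uopen (src (tag q)) (tagged q).2 /\
     c = line_class (tagged q).1 (tagged q).2}.
HB.instance Definition _ := gen_eqMixin line.
HB.instance Definition _ := gen_choiceMixin line.

Definition mk_line (s : S) (a : A s) (x : X) (h : Uopen (src s) x) : line :=
  exist _ (line_class a x)
    (ex_intro _ (Tagged (fun s => (fb A s * X)%type) (a, x)) (conj h erefl)).

(* v = [a, s, x] *)
Definition is_line (v : line) (s : S) (a : A s) (x : X) : Prop :=
  Uopen (src s) x /\ sval v = line_class a x.

Definition line_rep (v : line) : triple := projT1 (cid (svalP v)).

Lemma line_rep_Uopen (v : line) :
  Uopen (src (tag (line_rep v))) (tagged (line_rep v)).2.
Proof. exact: (projT2 (cid (svalP v))).1. Qed.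

Lemma germ_rep_Uopen (g : germ) : Uopen (src (germ_rep g).1) (germ_rep g).2.
Proof. exact: (projT2 (cid (svalP g))).1. Qed.

Definition line_proj (v : line) : germ := mk_germ (line_rep_Uopen v).

Definition line_add (v w : line) : line :=
  xget v [set u | exists s (a : A s) t (b : A t) x (e : idem S) (c : A (val e))
      (d : A (s * val e)%g),
    [/\ is_line v a x, is_line w b x, Uopen e x /\ ev x c = 1,
        delta d = delta (fb_mul b c) & is_line u (fb_mul a c + d) x]].

Definition line_scale (k : R[i]) (v : line) : line :=
  xget v [set w | exists s (a : A s) x, is_line v a x /\ is_line w (k *: a) x].

Definition line_zero (g : germ) : line := mk_line 0 (germ_rep_Uopen g).

Definition line_norm (v : line) : R :=
  Num.sqrt (complex.Re (sq (tagged (line_rep v)).2 (tagged (line_rep v)).1)).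

Definition line_bundle : bundle R line germ :=
  Bundle line_proj line_add line_scale line_zero line_norm.

Definition line_mul (v w : line) : line :=
  xget v [set u | exists s (a : A s) x t (b : A t) y, [/\ is_line v a x,
    is_line w b y, theta t y = x & is_line u (fb_mul a b) y]].

Definition line_star (v : line) : line :=
  xget v [set w | exists s (a : A s) x,
    is_line v a x /\ is_line w (fb_star a) (theta s x)].

(* The local section [s, x] |-> [a, s, x] on O_s. *)
Definition hat (s : S) (a : A s) (g : germ) : line :=
  xget (line_zero g) [set v | exists x, is_germ g s x /\ is_line v a x].

(* The defining property of the topology of L. *)
Definition is_line_topology (tau : Topological line) : Prop :=
  is_continuous_banach_bundle (line_bundle : bundle R (Topological.Pack tau) germ) /\
  forall s (a : A s), {within germ_open s (Uopen (src s)),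
    continuous (hat a : germ -> Topological.Pack tau)}.
End Germs.

(* Main.v *)
Require Import Defs.
From mathcomp Require Import all_boot all_order all_algebra.
From mathcomp Require Import complex ring lra finmap.
From mathcomp Require Import all_classical all_reals all_analysis.

Set Implicit Arguments.
Unset Strict Implicit.
Unset Printing Implicit Defensive.
Import Order.TTheory GRing.Theory Num.Theory numFieldNormedType.Exports.
Local Open Scope classical_set_scope.
Local Open Scope ring_scope.

(** All computations take place in the enveloping algebra [CA W], where the
    fibres of the bundle and the algebra [CE W] live side by side: [fibre s z]
    says that [z] comes from [A s], [inCE z] that [z] belongs to the copy of
    [CE W], and [cval x z] is the value of such a [z] at the character [x].
    Three facts carry the theorem.

    - Commutativity of the [A e] makes [CE W] commutative ([inCEC]).  For [z] and
      [w] in the fibre of [s] the product [z ⋅ w^†] lies over an idempotent, hence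
      commutes with every [b] in [CE W], and
        [(z^† ⋅ b ⋅ z) ⋅ (w^† ⋅ w) = (z^† ⋅ z) ⋅ (w^† ⋅ b ⋅ w)]
      ([sandwich_swap]).
    - Evaluated at [x], this identity says that the character
      [b |-> cval x (z^† ⋅ b ⋅ z) / cval x (z^† ⋅ z)] depends on [s] only; it is
      [theta s x] ([thetaP]).
    - For [b = w ⋅ w^†] it says that the Cauchy-Schwarz inequality for
      the form [cval x (z^† ⋅ w)] is an equality ([nsq_cross]).  So modulo the
      elements that vanish at [x] the fibre of [s] is at most a line, and by
      saturation it is a line exactly when [x] lies in the domain of [theta s]
      ([Uopen_srcP]).

    The maps [theta s] compose like the elements of the semigroup and
    [theta r] restricts [theta s] when [r <= s], so germs form a groupoid.  The
    neighbourhoods of the germ [[s, x]] are the images of those of [x] under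
    [y |-> [s, y]] ([nbhs_germ]); this reduces the étale axioms to the continuity
    of the [theta s].  The spectrum is locally compact because the characters that
    are bounded away from zero at a fixed element form a compact set, as in the
    Banach-Alaoglu theorem.

    Two triples represent the same element of [L] exactly when they have a common
    restriction up to elements vanishing at [x] ([is_line_common],
    [is_line_le]), and restrictions are stable under all the operations, which
    are therefore well defined.  Moreover every element of [L] over [[s, x]] is
    represented in [A s] itself ([line_rep_at]), so that each algebraic axiom for
    [L] follows from the corresponding identity in the bundle.

    The topology of [L] is accessible only through the sections [hat a] and the
    axioms of a continuous Banach bundle.  These give a criterion: a net [v_i]
    whose base points converge to [g] converges to [hat a g] if and only if the
    norm of [v_i - hat a (p v_i)] tends to zero ([cvg_hat], [hat_cvgP]).  With
    it the continuity of the product, of the involution and of the trivialisation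
    [(z, k) |-> k (hat a z)] over the germs where [a] does not vanish comes down
    to norm estimates in single fibres. *)

(** * Idempotents and the natural order of an inverse semigroup *)

Section InverseSemigroups.
Variable S : invSemigroupType.
Implicit Types (r s t u : S) (e f : idem S).
Local Open Scope group_scope.

Lemma val_src s : val (src s) = s^* * s. Proof. by []. Qed.

Lemma star_idem e : (val e)^* = val e.
Proof. by rewrite istar_idem ?idemP. Qed.

(** Both [e f] and [f e] are idempotent, and each is an inverse of the other. *)
Lemma idemC e f : val e * val f = val f * val e.
Proof.
have efef : val e * val f * (val e * val f) = val e * val f.
  exact: mul_idem_aux (idemP e) (idemP f).
have fefe : val f * val e * (val f * val e) = val f * val e.
  exact: mul_idem_aux (idemP f) (idemP e).
have eeA t : t * val e * val e = t * val e by rewrite -mulgA idemP.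
have ffA t : t * val f * val f = t * val f by rewrite -mulgA idemP.
rewrite -[LHS](istar_idem efef); apply/esym/istar_inv; rewrite !mulgA eeA ffA.
- by rewrite -[RHS]efef !mulgA.
- by rewrite -[RHS]fefe !mulgA.
Qed.

Lemma starK s : s^*^* = s.
Proof. by apply/esym/istar_inv; [exact: star_mul_star | exact: mul_star_mul]. Qed.

Lemma val_src_star s : val (src s^*) = s * s^*.
Proof. by rewrite val_src starK. Qed.

Lemma starM s t : (s * t)^* = t^* * s^*.
Proof.
have c : s^* * s * (t * t^*) = t * t^* * (s^* * s).
  by rewrite -(val_src s) -val_src_star idemC.
apply/esym/istar_inv.
- transitivity (s * (t * t^* * (s^* * s)) * t); first by rewrite !mulgA.
  by rewrite -c !mulgA mul_star_mul -!mulgA (mulgA t) mul_star_mul.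
- transitivity (t^* * (s^* * s * (t * t^*)) * s^*); first by rewrite !mulgA.
  by rewrite c !mulgA star_mul_star -!mulgA (mulgA s^*) star_mul_star.
Qed.

Lemma src_idem e : src (val e) = e.
Proof. by apply: val_inj; rewrite val_src star_idem idemP. Qed.

Lemma mul_src s : s * val (src s) = s.
Proof. by rewrite val_src mulgA mul_star_mul. Qed.

Lemma conj_idemP s e : (s^* * val e * s) * (s^* * val e * s) == s^* * val e * s.
Proof.
have c : s * s^* * val e = val e * (s * s^*) by rewrite -val_src_star idemC.
apply/eqP; transitivity (s^* * val e * (s * s^* * val e) * s).
  by rewrite !mulgA.
by rewrite c -!mulgA (mulgA s) mul_star_mul (mulgA (val e)) idemP.
Qed.

(** The idempotent [s^* e s], by which [e] moves across [s]; see [mul_conj_idem]. *)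
Definition conj_idem s e : idem S :=
  exist (fun s : S => s * s == s) _ (conj_idemP s e).

Lemma val_conj_idem s e : val (conj_idem s e) = s^* * val e * s. Proof. by []. Qed.

Lemma mul_conj_idem s e : s * val (conj_idem s e) = val e * s.
Proof.
rewrite val_conj_idem !mulgA -(val_src_star s) idemC val_src_star -!mulgA.
by rewrite (mulgA s) mul_star_mul.
Qed.

Lemma invleP s t : reflect (exists e, s = t * val e) (invle s t).
Proof.
apply: (iffP eqP) => [E|[e ->]].
  by exists (src s); rewrite val_src mulgA.
rewrite starM star_idem -!mulgA (mulgA t^*) -(val_src t) (mulgA _ _ (val e)).
by rewrite -(idemC (src t)) -mulgA idemP mulgA mul_src.
Qed.

Lemma mul_src_le s t : invle s t -> t * val (src s) = s.
Proof. by move/eqP=> {2}->; rewrite val_src mulgA. Qed.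

Lemma invle_mulr s e : invle (s * val e) s.
Proof. by apply/invleP; exists e. Qed.

Lemma invle_mull s e : invle (val e * s) s.
Proof. by rewrite -mul_conj_idem; exact: invle_mulr. Qed.

Lemma invle_refl s : invle s s.
Proof. by rewrite -{1}(mul_src s) invle_mulr. Qed.

Lemma invle_trans s r t : invle r s -> invle s t -> invle r t.
Proof.
move=> /invleP[e ->] /invleP[f ->]; apply/invleP; exists (idem_mul f e).
by rewrite -mulgA.
Qed.

Lemma invle_mul s t u r : invle s t -> invle u r -> invle (s * u) (t * r).
Proof.
move=> /invleP[e ->] /invleP[f ->].
apply: (@invle_trans (t * (val e * r))); last first.
  by rewrite -mul_conj_idem mulgA; exact: invle_mulr.
by rewrite !mulgA; exact: invle_mulr.
Qed.

Lemma invle_star s t : invle s t -> invle s^* t^*.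
Proof. by move=> /invleP[e ->]; rewrite starM star_idem; exact: invle_mull. Qed.

Lemma invle_src s t : invle s t -> invle (val (src s)) (val (src t)).
Proof. by move=> st; rewrite !val_src; apply: invle_mul => //; exact: invle_star. Qed.

Lemma src_mulr s e : val (src (s * val e)) = val (src s) * val e.
Proof.
rewrite val_src starM star_idem -mulgA (mulgA s^*) -val_src mulgA.
by rewrite -(idemC (src s)) -mulgA idemP.
Qed.
End InverseSemigroups.

(** * Linear maps and C*-algebras *)

Declare Scope cstar_scope.
Notation "a ⋅ b" := (cs_mul a b) (at level 40, left associativity) : cstar_scope.
Notation "a ^†" := (cs_star a) (at level 2, format "a ^†") : cstar_scope.
Local Open Scope cstar_scope.

Section LinearFunctions.
Variable R : realType.
Implicit Type k : R[i].

Section Algebraic.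
Variables (V U : lmodType R[i]) (f : V -> U).
Hypothesis fl : linear f.

Lemma linear_fun0 : f 0 = 0.
Proof. by have := fl (-1) 0 0; rewrite scaler0 addr0 scaleN1r addNr. Qed.
Lemma linear_funD a b : f (a + b) = f a + f b.
Proof. by have := fl 1 a b; rewrite !scale1r. Qed.
Lemma linear_funZ k a : f (k *: a) = k *: f a.
Proof. by have := fl k a 0; rewrite linear_fun0 !addr0. Qed.
Lemma linear_funB a b : f (a - b) = f a - f b.
Proof. by rewrite linear_funD -scaleN1r linear_funZ scaleN1r. Qed.
End Algebraic.

Lemma bounded_continuous (V U : normedModType R[i]) (f : V -> U) (M : R[i]) :
  0 <= M -> linear f -> (forall v, `|f v| <= M * `|v|) -> continuous f.
Proof.
move=> M0 fl fM v; have M1 : 0 < M + 1 by rewrite ltr_wpDl.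
apply/cvgrPdist_lt => e e0; near=> w.
rewrite -(linear_funB fl) (le_lt_trans (fM _))//.
rewrite (@le_lt_trans _ _ ((M + 1) * `|v - w|))//.
  by rewrite ler_wpM2r// lerDl.
rewrite mulrC -ltr_pdivlMr//; near: w.
apply/nbhs_ballP; exists (e / (M + 1)); first by rewrite /= divr_gt0.
by move=> w; rewrite -ball_normE.
Unshelve. all: by end_near. Qed.
End LinearFunctions.

Section CstarAlgebras.
Variables (R : realType) (D : cstarAlg R).
Implicit Types (a b c : D) (k : R[i]).

Lemma csmulDl a b c : (a + b) ⋅ c = a ⋅ c + b ⋅ c.
Proof. by have := cs_mul_linl c 1 a b; rewrite !scale1r. Qed.
Lemma csmulDr a b c : c ⋅ (a + b) = c ⋅ a + c ⋅ b.
Proof. by have := cs_mul_linr c 1 a b; rewrite !scale1r. Qed.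
Lemma csmul0l c : 0 ⋅ c = 0.
Proof. by apply: (addrI (0 ⋅ c)); rewrite -csmulDl !addr0. Qed.
Lemma csmul0r c : c ⋅ 0 = 0.
Proof. by apply: (addrI (c ⋅ 0)); rewrite -csmulDr !addr0. Qed.
Lemma csmulZl k a c : (k *: a) ⋅ c = k *: (a ⋅ c).
Proof. by have := cs_mul_linl c k a 0; rewrite csmul0l !addr0. Qed.
Lemma csmulZr k a c : c ⋅ (k *: a) = k *: (c ⋅ a).
Proof. by have := cs_mul_linr c k a 0; rewrite csmul0r !addr0. Qed.
Lemma csmulNl a c : (- a) ⋅ c = - (a ⋅ c).
Proof. by rewrite -scaleN1r csmulZl scaleN1r. Qed.
Lemma csmulNr a c : c ⋅ (- a) = - (c ⋅ a).
Proof. by rewrite -scaleN1r csmulZr scaleN1r. Qed.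
Lemma csmulBl a b c : (a - b) ⋅ c = a ⋅ c - b ⋅ c.
Proof. by rewrite csmulDl csmulNl. Qed.
Lemma csmulBr a b c : c ⋅ (a - b) = c ⋅ a - c ⋅ b.
Proof. by rewrite csmulDr csmulNr. Qed.

Lemma csstarD a b : (a + b)^† = a^† + b^†.
Proof. by have := cs_star_lin 1 a b; rewrite !scale1r conjC1 scale1r. Qed.
Lemma csstar0 : (0 : D)^† = 0.
Proof. by apply: (addrI 0^†); rewrite -csstarD !addr0. Qed.
Lemma csstarZ k a : (k *: a)^† = k^* *: a^†.
Proof. by have := cs_star_lin k a 0; rewrite csstar0 !addr0. Qed.
Lemma csstarN a : (- a)^† = - a^†.
Proof. by rewrite -scaleN1r csstarZ rmorphN1 scaleN1r. Qed.
Lemma csstarB a b : (a - b)^† = a^† - b^†.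
Proof. by rewrite csstarD csstarN. Qed.

Lemma csstar_mul_eq0 a : a^† ⋅ a = 0 -> a = 0.
Proof.
move=> a0; have := cs_cstar a; rewrite a0 normr0 => /esym/eqP.
by rewrite expf_eq0 normr_eq0 => /eqP.
Qed.

Lemma norm_realE (V : normedModType R[i]) (v : V) : exists2 r : R, 0 <= r & `|v| = r%:C%C.
Proof.
have := normr_ge0 v; case: `|v| => r i; rewrite lecE/= => /andP[/eqP-> r0].
by exists r.
Qed.

(** After scaling one may suppose that [chi c = 1] and [|c| < 1]; then the powers
    of [c] tend to zero although [chi] takes the value one on each of them. *)
Lemma char_le_norm (chi : D -> R[i]^o) c : is_character chi -> `|chi c| <= `|c|.
Proof.
move=> [chil chim _ chic _].
rewrite real_leNgt ?normr_real//; apply/negP => lt_c.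
have chi_gt0 : 0 < `|chi c| by apply: le_lt_trans lt_c.
have chi_neq0 : chi c != 0 by rewrite -normr_gt0.
pose d := (chi c)^-1 *: c.
have chid : chi d = 1 by rewrite (linear_funZ chil) -[LHS]/(_ * _) mulVf.
have [r r0 dr] := norm_realE d.
have r1 : r < 1.
  rewrite -ltcR -dr normrZ normfV mulrC ltr_pdivrMr ?mul1r//.
pose p n := iter n (cs_mul d) d.
have chip n : chi (p n) = 1 by elim: n => //= n IH; rewrite chim chid IH mulr1.
have pr n : `|p n| <= (r ^+ n.+1)%:C%C.
  elim: n => /= [|n IH]; first by rewrite dr expr1.
  rewrite (le_trans (cs_norm_mul _ _))// dr exprS rmorphM/= ler_wpM2l//.
  by rewrite ler0c.
have /cvgrPdist_lt /(_ _ ltr01) := chic 0.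
rewrite (linear_fun0 chil) => /nbhs_ballP[e /= e0 He].
have [e' e'E] : exists e', e = e'%:C%C.
  by exists (complex.Re e); rewrite RRe_real// gtr0_real.
have e'0 : 0 < e' by rewrite -ltcR -e'E.
have /cvgrPdist_lt/(_ _ e'0) : r ^+ n @[n --> \oo] --> 0.
  by apply: cvg_expr; rewrite ger0_norm.
case=> n _ /(_ n.+1 (leqnSn n)); rewrite sub0r normrN ger0_norm ?exprn_ge0// => re.
have := He (p n); rewrite -ball_normE/= !sub0r !normrN chip normr1 ltxx => H.
by suff : false by []; apply: H; rewrite e'E (le_lt_trans (pr n))// ltcR.
Qed.
End CstarAlgebras.

(** * The enveloping algebras *)

Local Notation incl := Defs.incl.

Section Envelope.
Variables (R : realType) (S : invSemigroupType) (A : fellBundle R S).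
Variable W : envelopes A.
Implicit Types (r s t u : S) (e f : idem S) (k : R[i]).

Definition emb s (a : A s) : CA W := iA W [:: delta a].

Lemma emb_eq s t (a : A s) (b : A t) : delta a = delta b -> emb a = emb b.
Proof. by rewrite /emb => ->. Qed.

Let iAhom : fs_star_hom (@iA _ _ _ W). Proof. by have [] := iA_env W. Qed.
Let iEhom : fs_star_hom (@iE _ _ _ W). Proof. by have [] := iE_env W. Qed.

Lemma untag_deltaD r s (a b : A r) :
  untag 0 (fun a : A s => a) (delta (a + b)) =
  untag 0 (fun a : A s => a) (delta a) + untag 0 (fun a : A s => a) (delta b).
Proof.
have [E|ne] := eqVneq r s; last by rewrite !untag_dflt//= addr0.
by case: s / E; rewrite !(untagE _ _ (erefl : tag (delta _) = r)).
Qed.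

Lemma embD s (a b : A s) : emb (a + b) = emb a + emb b.
Proof.
rewrite /emb -(fs_hom_add iAhom); apply: (fs_hom_eq iAhom).
exists [::]; first exact: fs_ideal_nil.
by move=> r; rewrite /fs_coef cats0 !big_cons big_nil !addr0 untag_deltaD.
Qed.

Lemma emb0 s : emb (0 : A s) = 0.
Proof. by apply: (addrI (emb (0 : A s))); rewrite -embD !addr0. Qed.

Lemma embZ s k (a : A s) : emb (k *: a) = k *: emb a.
Proof. by rewrite /emb -(fs_hom_scale iAhom). Qed.

Lemma embB s (a b : A s) : emb (a - b) = emb a - emb b.
Proof. by rewrite embD -scaleN1r embZ scaleN1r. Qed.

Lemma embM s t (a : A s) (b : A t) : emb (fb_mul a b) = emb a ⋅ emb b.
Proof. by rewrite /emb -(fs_hom_mul iAhom). Qed.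

Lemma emb_star s (a : A s) : emb (fb_star a) = (emb a)^†.
Proof. by rewrite /emb -(fs_hom_star iAhom). Qed.

Lemma emb_j s t (st : invle s t) (a : A s) : emb (fb_j A st a) = emb a.
Proof.
apply/esym/(fs_hom_eq iAhom).
exists [:: delta a; delta (- fb_j A st a)].
  by apply: fs_ideal_cons; exact: fs_ideal_nil.
move=> r; rewrite /fs_coef !big_cons big_nil !addr0 addrCA -untag_deltaD subrr.
rewrite [X in _ = _ + X](_ : _ = 0) ?addr0//.
have [E|ne] := eqVneq t r; last by rewrite untag_dflt.
by case: r / E; rewrite !(untagE _ _ (erefl : tag (delta _) = t)).
Qed.

(** A predicate on [CA W] rather than a type: an equality of indices such as
    [s * (t * r) = s * t * r], or an inclusion [A s] into [A t], then needs no cast. *)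
Definition fibre s (z : CA W) : Prop := exists a : A s, emb a = z.

Definition inCE (z : CA W) : Prop := exists c, incl c = z.

Lemma fibre_emb s (a : A s) : fibre s (emb a). Proof. by exists a. Qed.
Lemma fibreD s z w : fibre s z -> fibre s w -> fibre s (z + w).
Proof. by move=> [a <-] [b <-]; exists (a + b); rewrite embD. Qed.
Lemma fibreZ s k z : fibre s z -> fibre s (k *: z).
Proof. by move=> [a <-]; exists (k *: a); rewrite embZ. Qed.
Lemma fibreB s z w : fibre s z -> fibre s w -> fibre s (z - w).
Proof. by move=> [a <-] [b <-]; exists (a - b); rewrite embB. Qed.
Lemma fibreM s t z w : fibre s z -> fibre t w -> fibre (s * t)%g (z ⋅ w).
Proof. by move=> [a <-] [b <-]; exists (fb_mul a b); rewrite embM. Qed.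
Lemma fibre_star s z : fibre s z -> fibre s^*%g z^†.
Proof. by move=> [a <-]; exists (fb_star a); rewrite emb_star. Qed.
Lemma fibre_le s t z : invle s t -> fibre s z -> fibre t z.
Proof. by move=> st [a <-]; exists (fb_j A st a); rewrite emb_j. Qed.
Lemma fibre_eq s t z : s = t -> fibre s z -> fibre t z.
Proof. by move=> ->. Qed.

Lemma fibre_conj s e z w : fibre s z -> fibre (val e) w ->
  fibre (val (conj_idem s e)) (z^† ⋅ w ⋅ z).
Proof. by move=> zs we; do 2![apply: fibreM => //]; exact: fibre_star. Qed.

Lemma fibre_src s z w : fibre s z -> fibre s w -> fibre (val (src s)) (z^† ⋅ w).
Proof. by move=> zs ws; apply: fibreM => //; exact: fibre_star. Qed.

Lemma fibre_src_star s z w : fibre s z -> fibre s w ->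
  fibre (val (src s^*%g)) (z ⋅ w^†).
Proof.
move=> zs ws; apply: (@fibre_eq (s * s^*)%g); first by rewrite val_src_star.
by apply: fibreM => //; exact: fibre_star.
Qed.

Lemma incl_emb e (a : A (val e)) :
  incl (iE W [:: @delta R _ (restr A) e a]) = emb a.
Proof. by rewrite incl_iE. Qed.

Lemma fibre_inCE e z : fibre (val e) z -> inCE z.
Proof. by move=> [a <-]; exists (iE W [:: @delta R _ (restr A) e a]); rewrite incl_emb. Qed.

Let inclL : linear (@incl _ _ _ W) := @incl_linear _ _ _ W.

Lemma incl_inj : injective (@incl _ _ _ W).
Proof.
move=> c d cd; apply/eqP; rewrite -subr_eq0 -normr_eq0 -incl_norm.
by rewrite (linear_funB inclL) cd subrr normr0.
Qed.

Lemma inCE0 : inCE 0. Proof. by exists 0; rewrite (linear_fun0 inclL). Qed.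
Lemma inCED z w : inCE z -> inCE w -> inCE (z + w).
Proof. by move=> [c <-] [d <-]; exists (c + d); rewrite (linear_funD inclL). Qed.
Lemma inCEZ k z : inCE z -> inCE (k *: z).
Proof. by move=> [c <-]; exists (k *: c); rewrite (linear_funZ inclL). Qed.
Lemma inCEM z w : inCE z -> inCE w -> inCE (z ⋅ w).
Proof. by move=> [c <-] [d <-]; exists (c ⋅ d); rewrite incl_mul. Qed.
Lemma inCE_star z : inCE z -> inCE z^†.
Proof. by move=> [c <-]; exists c^†; rewrite incl_star. Qed.

(** An isometric image of a complete space is closed. *)
Lemma inCE_closed : closed inCE.
Proof.
move=> z zcl; pose F : set_system (CE W) :=
  [set P | exists2 Q, nbhs z Q & forall c, Q (incl c) -> P c].
have Fball (e : R[i]) : 0 < e -> F [set c | `|z - incl c| < e].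
  by move=> e0; exists (ball z e) => [|c]; [exact: nbhsx_ballx|rewrite -ball_normE].
have FF : ProperFilter F.
  split; first by move=> [Q /zcl[_ [[c <-] Qc]] /(_ c Qc)].
  split; first by exists setT => //; exact: filterT.
  - move=> P Q [P' zP' HP] [Q' zQ' HQ]; exists (P' `&` Q'); first exact: filterI.
    by move=> c [/HP ? /HQ].
  - by move=> P Q PQ [P' zP' HP]; exists P' => // c /HP /PQ.
have Fc : cauchy F.
  apply/cauchy_exP => e e0; have e20 : 0 < e / 2 by rewrite divr_gt0.
  have [c zc] := filter_ex (Fball _ e20); exists c.
  apply: filterS (Fball _ e20) => d /= zd.
  rewrite -ball_normE/= -incl_norm (linear_funB inclL).
  rewrite -(subrK z (incl c)) -addrA (le_lt_trans (ler_normD _ _))//.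
  by rewrite (splitr e) ltrD// distrC.
have [c Fl] : exists c : CE W, F --> c by exists (lim F); exact: cauchy_cvg.
exists c; apply/eqP; rewrite -subr_eq0 -normr_le0; apply/negP.
move=> /negP; rewrite -real_ltNge ?normr_real// => e0.
have e20 : 0 < `|incl c - z| / 2 by rewrite divr_gt0.
have : F (ball c (`|incl c - z| / 2)) by apply: Fl; exact: nbhsx_ballx.
move=> /(filterI (Fball _ e20)) /filter_ex[d [/= zd]].
rewrite -ball_normE/= -incl_norm (linear_funB inclL) => cd.
have := ler_normD (incl c - incl d) (incl d - z).
rewrite subrKA => /le_lt_trans -/(_ `|incl c - z|).
rewrite ltxx => H; suff : false by []; apply: H.
by rewrite [X in _ < X]splitr ltrD// distrC.
Qed.

(** Finite sums of elements of the [A e] are dense. *)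
Lemma CE_ind (P : set (CE W)) : closed P -> P 0 ->
  (forall e (a : A (val e)) c, P c -> P (iE W [:: @delta R _ (restr A) e a] + c)) ->
  forall c, P c.
Proof.
move=> Pcl P0 PD c; have [_ idense _] := iE_env W; apply: Pcl => B Bc.
have [y [By [u _ uy]]] : (B° `&` range (iE W)) !=set0.
  by apply: idense (open_interior B); exists c.
exists y; split; last exact: interior_subset.
rewrite -uy; elim: u {uy} => [|[e a] u IH]; last first.
  by rewrite -cat1s (fs_hom_add iEhom); exact: PD.
rewrite (_ : [::] = fs_scale 0 [::] :> fsum (restr A))//.
by rewrite (fs_hom_scale iEhom) scale0r.
Qed.

Let conjL (z w : CA W) : linear (fun c : CE W => z ⋅ incl c ⋅ w).
Proof. by move=> k c d; rewrite inclL csmulDr csmulDl csmulZr csmulZl. Qed.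

Let conj_continuous (z w : CA W) : continuous (fun c : CE W => z ⋅ incl c ⋅ w).
Proof.
apply: (@bounded_continuous _ _ _ _ (`|z| * `|w|) _ (conjL z w)).
  by rewrite mulr_ge0.
move=> c; rewrite mulrAC (le_trans (cs_norm_mul _ _))// ler_wpM2r//.
by rewrite (le_trans (cs_norm_mul _ _))// incl_norm.
Qed.

(** Conjugation by [z] maps [A e] into the fibre of [s^* e s]; the general case
    follows by density. *)
Lemma inCE_conj s z w : fibre s z -> inCE w -> inCE (z^† ⋅ w ⋅ z).
Proof.
move=> zs [c <-].
apply: (@CE_ind [set c | inCE (z^† ⋅ incl c ⋅ z)]).
- by apply: (closed_comp _ inCE_closed) => d _; exact: conj_continuous.
- by rewrite /= (linear_fun0 (conjL _ _)); exact: inCE0.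
- move=> e a d /= Hd; rewrite (linear_funD (conjL _ _)); apply: inCED => //.
  apply: (@fibre_inCE (conj_idem s e)); apply: fibre_conj => //.
  by rewrite incl_emb; exact: fibre_emb.
Qed.

Hypothesis Aab : semi_abelian A.

(** The commutator [d] of [z] and [w] lies over [e f].  For [c] over [e f], both [c]
    and [w ⋅ c] commute with [z] as elements of [A e], so that
    [z ⋅ w ⋅ c = w ⋅ c ⋅ z = w ⋅ z ⋅ c].  Hence [d] annihilates all such [c], among
    them its own adjoint. *)
Lemma fibre_idemC e f z w : fibre (val e) z -> fibre (val f) w -> z ⋅ w = w ⋅ z.
Proof.
have abC (g : idem S) a b : fibre (val g) a -> fibre (val g) b -> a ⋅ b = b ⋅ a.
  by move=> [a' <-] [b' <-]; rewrite -!embM Aab.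
move=> ze wf; pose d := z ⋅ w - w ⋅ z.
have le_e : invle (val e * val f)%g (val e) by exact: invle_mulr.
have le_f : invle (val e * val f)%g (val f) by exact: invle_mull.
have defib : fibre (val (idem_mul e f)) d.
  apply: fibreB; first exact: fibreM.
  by apply: (@fibre_eq (val f * val e)%g); [exact: idemC|exact: fibreM].
have dc c : fibre (val (idem_mul e f)) c -> d ⋅ c = 0.
  move=> cef; rewrite csmulBl -!cs_mulA.
  have wc : fibre (val e) (w ⋅ c).
    apply: (fibre_le le_e); apply: (@fibre_eq (val f * (val e * val f))%g).
      by rewrite (idemC e) mulgA idemP.
    exact: fibreM.
  rewrite (abC e z) // -cs_mulA (abC e z c) ?subrr//; exact: fibre_le cef.
apply/eqP; rewrite -subr_eq0 -/d; apply/eqP.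
rewrite -(cs_starK d) (@csstar_mul_eq0 _ _ d^†) ?csstar0//.
rewrite cs_starK; apply: dc; apply: (@fibre_eq (val (idem_mul e f))^*%g).
  by rewrite star_idem.
exact: fibre_star.
Qed.

Let commL (w : CA W) : linear (fun c : CE W => incl c ⋅ w - w ⋅ incl c).
Proof.
by move=> k c d; rewrite inclL csmulDr csmulDl csmulZr csmulZl opprD addrACA -scalerBr.
Qed.

Let comm_closed (w : CA W) : closed [set c : CE W | incl c ⋅ w = w ⋅ incl c].
Proof.
rewrite (_ : mkset _ = (fun c : CE W => incl c ⋅ w - w ⋅ incl c) @^-1` [set 0]).
  apply: closed_comp => [c _|].
    apply: (@bounded_continuous _ _ _ _ (`|w| + `|w|) _ (commL w)) => [|d].
      by rewrite addr_ge0.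
    rewrite (le_trans (ler_normB _ _))// mulrDl lerD//.
      by rewrite mulrC -incl_norm; exact: cs_norm_mul.
    by rewrite -incl_norm; exact: cs_norm_mul.
  exact/accessible_closed_set1/hausdorff_accessible/norm_hausdorff.
by apply/seteqP; split=> c /=; [move=> ->; rewrite subrr|move/eqP; rewrite subr_eq0 => /eqP].
Qed.

Lemma inCEC z w : inCE z -> inCE w -> z ⋅ w = w ⋅ z.
Proof.
have H c y : (forall e (a : A (val e)), emb a ⋅ y = y ⋅ emb a) -> 
    incl (e:=W) c ⋅ y = y ⋅ incl c.
  move=> Hy; pose P := [set c : CE W | incl c ⋅ y = y ⋅ incl c].
  apply: (@CE_ind P (@comm_closed y) _ _ c).
    by rewrite /P /= (linear_fun0 inclL) csmul0l csmul0r.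
  move=> e a d; rewrite /P /= => Hd; rewrite (linear_funD inclL) csmulDl csmulDr Hd.
  by rewrite incl_emb Hy.
move=> [c <-] [d <-]; apply: (H) => e a; apply/esym/H => f b.
by apply: fibre_idemC; exact: fibre_emb.
Qed.

(** The middle factor [z ⋅ w^†] lies over an idempotent, so it commutes with [b]. *)
Lemma sandwich_swap s z w b : fibre s z -> fibre s w -> inCE b ->
  (z^† ⋅ b ⋅ z) ⋅ (w^† ⋅ w) = (z^† ⋅ z) ⋅ (w^† ⋅ b ⋅ w).
Proof.
move=> zs ws bB.
have zw : inCE (z ⋅ w^†) by apply: fibre_inCE; exact: (fibre_src_star zs ws).
transitivity (z^† ⋅ (b ⋅ (z ⋅ w^†)) ⋅ w); first by rewrite !cs_mulA.
by rewrite (inCEC bB zw) !cs_mulA.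
Qed.

Lemma sandwich_mul s z b c : fibre s z -> inCE b -> inCE c ->
  (z^† ⋅ b ⋅ z) ⋅ (z^† ⋅ c ⋅ z) = (z^† ⋅ z) ⋅ (z^† ⋅ (b ⋅ c) ⋅ z).
Proof.
move=> zs bB cB.
have zz : inCE (z ⋅ z^†) by apply: fibre_inCE; exact: (fibre_src_star zs zs).
transitivity (z^† ⋅ (b ⋅ (z ⋅ z^†)) ⋅ c ⋅ z); first by rewrite !cs_mulA.
by rewrite (inCEC bB zz) !cs_mulA.
Qed.

End Envelope.

(** * Values at a character *)

Section Values.
Variables (R : realType) (S : invSemigroupType) (A : fellBundle R S).
Hypothesis Aab : semi_abelian A.
Variable W : envelopes A.
Local Notation X := (spectrum (CE W)).
Local Notation emb := (@emb R S A W).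
Local Notation fibre := (@fibre R S A W).
Local Notation inCE := (@inCE R S A W).
Implicit Types (r s t u : S) (e f : idem S) (k : R[i]) (x y : X) (z w b c : CA W).

(** The default value zero is taken outside the image of [CE W]. *)
Definition cval x z : R[i] := val x (xget 0 [set c | incl c = z]).

Lemma cval_incl x (c : CE W) : cval x (incl c) = val x c.
Proof.
by rewrite /cval; case: xgetP => [d _ /incl_inj -> //|/(_ c)]; case.
Qed.

Lemma xchar x : is_character (val x). Proof. exact: set_mem (valP x). Qed.

Lemma cvalD x z w : inCE z -> inCE w -> cval x (z + w) = cval x z + cval x w.
Proof.
move=> [c <-] [d <-]; rewrite -(linear_funD (@incl_linear _ _ _ W)) !cval_incl.
by rewrite (linear_funD (char_linear (xchar x))).
Qed.

Lemma cvalZ x k z : inCE z -> cval x (k *: z) = k * cval x z.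
Proof.
move=> [c <-]; rewrite -(linear_funZ (@incl_linear _ _ _ W)) !cval_incl.
by rewrite (linear_funZ (char_linear (xchar x))).
Qed.

Lemma cvalM x z w : inCE z -> inCE w -> cval x (z ⋅ w) = cval x z * cval x w.
Proof. by move=> [c <-] [d <-]; rewrite -incl_mul !cval_incl (char_mul (xchar x)). Qed.

Lemma cval_star x z : inCE z -> cval x z^† = (cval x z)^*.
Proof. by move=> [c <-]; rewrite -incl_star !cval_incl (char_star (xchar x)). Qed.

Lemma cval0 x : cval x 0 = 0.
Proof.
rewrite -(linear_fun0 (@incl_linear _ _ _ W)) cval_incl.
exact: (linear_fun0 (char_linear (xchar x))).
Qed.

Lemma cval_inj x y : (forall z, inCE z -> cval x z = cval y z) -> x = y.
Proof.
move=> H; apply/val_inj/funext => c; rewrite -!cval_incl; apply: H.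
by exists c.
Qed.

Lemma evE x e (a : A (val e)) : ev x a = cval x (emb a).
Proof. by rewrite -incl_emb cval_incl. Qed.

(** The squared seminorm at [x]; on a fibre it comes from the semi-inner product
    [cval x (z^† ⋅ w)]. *)
Definition nsq x z : R[i] := cval x (z^† ⋅ z).

Lemma sqE x s (a : A s) : sq x a = nsq x (emb a).
Proof. by rewrite /sq evE embM emb_star. Qed.

Lemma UopenP e x : Uopen e x <-> exists2 z, fibre (val e) z & cval x z != 0.
Proof.
split=> [[a]|[_ [a <-]]]; first by rewrite evE; exists (emb a) => //; exact: fibre_emb.
by rewrite -evE; exists a.
Qed.

Lemma inCE_cross s z w : fibre s z -> fibre s w -> inCE (z^† ⋅ w).
Proof. by move=> zs ws; apply: fibre_inCE; exact: (fibre_src zs ws). Qed.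

Lemma inCE_cross_star s z w : fibre s z -> fibre s w -> inCE (z ⋅ w^†).
Proof. by move=> zs ws; apply: fibre_inCE; exact: (fibre_src_star zs ws). Qed.

Lemma nsq_ge0 x s z : fibre s z -> 0 <= nsq x z.
Proof.
move=> [a <-]; have [b] := fb_pos a.
have bE : fibre (val (src s)) (emb b) by exact: fibre_emb.
move=> /(@emb_eq _ _ _ W); rewrite !embM !emb_star /nsq => ->.
have bB := fibre_inCE bE.
by rewrite cvalM ?cval_star//; [rewrite mulrC mul_conjC_ge0|exact: inCE_star].
Qed.

Lemma nsq_real x s z : fibre s z -> (nsq x z)^* = nsq x z.
Proof. by move=> zs; apply/CrealP/ger0_real/(nsq_ge0 x zs). Qed.

Lemma cval_cross_conj x s z w : fibre s z -> fibre s w ->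
  cval x (w^† ⋅ z) = (cval x (z^† ⋅ w))^*.
Proof.
by move=> zs ws; rewrite -cval_star ?cs_star_mul ?cs_starK//; exact: (inCE_cross zs ws).
Qed.

(** The square of [z^† ⋅ b ⋅ z] is a multiple of [z^† ⋅ z]. *)
Lemma cval_conj0 x s z b : fibre s z -> inCE b -> nsq x z = 0 ->
  cval x (z^† ⋅ b ⋅ z) = 0.
Proof.
move=> zs bB z0; have zbz := inCE_conj zs bB.
have /(congr1 (cval x)) := sandwich_mul Aab zs bB bB.
rewrite [RHS]cvalM -/(nsq x z) ?z0 ?mul0r; last 2 first.
- exact: (inCE_cross zs zs).
- by apply: (inCE_conj zs); exact: inCEM.
by rewrite cvalM// => /eqP; rewrite mulf_eq0 orbb => /eqP.
Qed.

Lemma conj_crossE z w : w^† ⋅ (z ⋅ z^†) ⋅ w = (w^† ⋅ z) ⋅ (z^† ⋅ w).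
Proof. by rewrite !cs_mulA. Qed.

(** The Cauchy-Schwarz inequality is an equality: the left-hand side is the value
    of [w^† ⋅ (z ⋅ z^†) ⋅ w], to which [sandwich_swap] applies. *)
Lemma nsq_cross x s z w : fibre s z -> fibre s w ->
  `|cval x (z^† ⋅ w)| ^+ 2 = nsq x z * nsq x w.
Proof.
move=> zs ws; have zz := inCE_cross_star zs zs; have ww := inCE_cross_star ws ws.
have zw := inCE_cross zs ws; have wz := inCE_cross ws zs.
rewrite normCKC -(cval_cross_conj x zs ws) -cvalM// -conj_crossE.
have [w0|w0] := eqVneq (nsq x w) 0.
  by rewrite w0 mulr0; exact: (cval_conj0 ws zz w0).
(* both sides are multiplied by the nonzero value of [w^† ⋅ w] *)
rewrite conj_crossE (inCEC Aab wz zw) -conj_crossE; apply: (mulIf w0).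
rewrite -[in LHS]cvalM; [|exact: (inCE_conj zs)|exact: (inCE_cross ws ws)].
rewrite (sandwich_swap Aab zs ws ww) cvalM; last 2 first.
- exact: (inCE_cross zs zs).
- exact: (inCE_conj ws).
rewrite conj_crossE -/(nsq x z) -mulrA; congr (_ * _).
by apply: cvalM; exact: (inCE_cross ws ws).
Qed.

Lemma nsq0_crossl x s z w : fibre s z -> fibre s w -> nsq x z = 0 ->
  cval x (z^† ⋅ w) = 0.
Proof.
move=> zs ws z0; have /eqP := nsq_cross x zs ws.
by rewrite z0 mul0r expf_eq0/= normr_eq0 => /eqP.
Qed.

Lemma nsq0_crossr x s z w : fibre s z -> fibre s w -> nsq x w = 0 ->
  cval x (z^† ⋅ w) = 0.
Proof.
by move=> zs ws w0; rewrite (cval_cross_conj x ws zs) (nsq0_crossl ws zs w0) conjC0.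
Qed.

Lemma nsqDE x s z w : fibre s z -> fibre s w ->
  nsq x (z + w) = nsq x z + cval x (z^† ⋅ w) + (cval x (w^† ⋅ z) + nsq x w).
Proof.
move=> zs ws; rewrite /nsq csstarD csmulDl !csmulDr !cvalD//;
  by [exact: (inCE_cross zs)|exact: (inCE_cross ws)|apply: inCED;
  first [exact: (inCE_cross zs)|exact: (inCE_cross ws)]].
Qed.

Lemma nsqZ x s k z : fibre s z -> nsq x (k *: z) = `|k| ^+ 2 * nsq x z.
Proof.
move=> zs; rewrite /nsq csstarZ csmulZl csmulZr scalerA cvalZ ?normCKC//.
exact: (inCE_cross zs zs).
Qed.

Lemma nsq0D x s z w : fibre s z -> fibre s w ->
  nsq x z = 0 -> nsq x w = 0 -> nsq x (z + w) = 0.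
Proof.
move=> zs ws z0 w0; rewrite (nsqDE x zs ws) z0 w0.
by rewrite (nsq0_crossl zs ws z0) (nsq0_crossl ws zs w0) !addr0.
Qed.

Lemma nsq0N x s z : fibre s z -> nsq x z = 0 -> nsq x (- z) = 0.
Proof. by move=> zs z0; rewrite -scaleN1r (nsqZ _ _ zs) z0 mulr0. Qed.

Lemma nsq0_trans x s z w v : fibre s z -> fibre s w -> fibre s v ->
  nsq x (z - w) = 0 -> nsq x (w - v) = 0 -> nsq x (z - v) = 0.
Proof.
move=> zs ws vs zw wv; rewrite -(subrKA w).
by apply: (@nsq0D x s); rewrite //; exact: fibreB.
Qed.

Lemma nsq0_sym x s z w : fibre s z -> fibre s w ->
  nsq x (z - w) = 0 -> nsq x (w - z) = 0.
Proof. by move=> zs ws zw; rewrite -opprB; apply: (@nsq0N x s) => //; exact: fibreB. Qed.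

Lemma nsq0_eq x s z w : fibre s z -> fibre s w -> nsq x (z - w) = 0 ->
  nsq x z = nsq x w.
Proof.
move=> zs ws zw; have zws := fibreB zs ws.
rewrite -{1}(subrK w z) (nsqDE x zws ws) zw.
by rewrite (nsq0_crossl zws ws zw) (nsq0_crossr ws zws zw) !add0r.
Qed.

Lemma nsqMr x s z b : fibre s z -> inCE b ->
  nsq x (z ⋅ b) = `|cval x b| ^+ 2 * nsq x z.
Proof.
move=> zs bB; have zz := inCE_cross zs zs.
rewrite /nsq cs_star_mul -cs_mulA (cs_mulA z^†) cvalM; last 2 first.
- exact: inCE_star.
- exact: inCEM.
by rewrite cvalM// cval_star// mulrCA -normCKC mulrC.
Qed.

(** Modulo elements vanishing at [x], multiplication by [b] is multiplication by
    the scalar [cval x b]. *)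
Lemma nsq_subMr x e s z b : fibre s z -> fibre (val e) b ->
  cval x b = 1 -> nsq x (z - z ⋅ b) = 0.
Proof.
move=> zs be b1; have bB := fibre_inCE be.
have zbs : fibre s (z ⋅ b).
  by apply: (fibre_le (invle_mulr s e)); exact: fibreM.
have zz := inCE_cross zs zs.
have nzs : fibre s (- (z ⋅ b)) by rewrite -scaleN1r; exact: fibreZ.
rewrite (nsqDE x zs nzs) -scaleN1r (nsqZ _ _ zbs) (nsqMr x zs bB) b1.
rewrite csstarZ csmulZl csmulZr rmorphN1 normrN !normr1 !expr1n !mul1r.
rewrite cs_star_mul cs_mulA -(cs_mulA b^†).
have zzb : inCE (z^† ⋅ z ⋅ b) by exact: inCEM.
have bzz : inCE (b^† ⋅ (z^† ⋅ z)) by apply: inCEM => //; exact: inCE_star.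
have bs : inCE b^† by exact: inCE_star.
rewrite !cvalZ// (cvalM x zz bB) (cvalM x bs zz).
by rewrite cval_star// b1 conjC1 mul1r mulr1 -/(nsq x z) mulN1r subrr addNr addr0.
Qed.
End Values.

(** * The characters [theta s x] *)

(** The iterates of [v |-> a + f v] at zero, which are the partial sums of a Neumann
    series, form a Cauchy sequence. *)
Lemma contraction_fixpoint (R : realType) (V : completeNormedModType R[i])
    (f : V -> V) (r : R) (a : V) : linear f -> 0 <= r < 1 ->
  (forall v, `|f v| <= r%:C%C * `|v|) -> exists y, y = a + f y.
Proof.
move=> fl /andP[r0 r1] fr; pose y n := iter n (fun v => a + f v) 0.
have [c c0 aE] := norm_realE a; pose K := c / (1 - r).
have r1' : 0 < 1 - r by rewrite subr_gt0.
have yK n : `|y n| <= K%:C%C.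
  elim: n => /= [|n IH]; first by rewrite normr0 ler0c divr_ge0// ltW.
  rewrite (le_trans (ler_normD _ _))//.
  have -> : K = c + r * K by rewrite /K; field; rewrite gt_eqF.
  rewrite rmorphD/= -aE lerD2l (le_trans (fr _))// rmorphM/= ler_wpM2l//.
  by rewrite ler0c.
have yd k n : `|y (n + k)%N - y k| <= (r ^+ k * K)%:C%C.
  elim: k => [|k IH]; first by rewrite addn0 subr0 expr0 mul1r.
  rewrite addnS /= opprD addrACA subrr add0r -(linear_funB fl).
  rewrite (le_trans (fr _))// exprS -mulrA rmorphM/= ler_wpM2l//.
  by rewrite ler0c.
have yc : cauchy (y @ \oo).
  apply/cauchy_exP => e e0.
  have [e' eE] : exists e', e = e'%:C%C.
    by exists (complex.Re e); rewrite RRe_real// gtr0_real.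
  have e'0 : 0 < e' by rewrite -ltcR -eE.
  have : r ^+ n * K @[n --> \oo] --> 0 * K.
    by apply: cvgMl; apply: cvg_expr; rewrite ger0_norm.
  rewrite mul0r => /cvgrPdist_lt/(_ _ e'0)[k _ /(_ k (leqnn k))].
  have Kp : 0 <= r ^+ k * K by rewrite mulr_ge0 ?exprn_ge0// divr_ge0// ltW.
  rewrite sub0r normrN ger0_norm// => Hk.
  exists (y k); exists k => // n /= kn; rewrite -ball_normE/= distrC.
  by rewrite -(subnK kn) eE (le_lt_trans (yd _ _))// ltcR.
have [l yl] : exists l : V, y @ \oo --> l.
  by exists (lim (y @ \oo)); exact: cauchy_cvg.
exists l; have fc : continuous f.
  by apply: (@bounded_continuous _ _ _ _ r%:C%C); rewrite // ler0c.
apply: (@cvg_unique _ (@norm_hausdorff _ V) (y n.+1 @[n --> \oo])).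
  by move: yl; rewrite -(cvg_shiftS y).
apply: cvgD; first exact: cvg_cst.
by apply: continuous_cvg => //; exact: fc.
Qed.

Section Characters.
Variables (R : realType) (S : invSemigroupType) (A : fellBundle R S).
Hypothesis Aab : semi_abelian A.
Variable W : envelopes A.
Local Notation X := (spectrum (CE W)).
Local Notation emb := (@emb R S A W).
Local Notation fibre := (@fibre R S A W).
Local Notation inCE := (@inCE R S A W).
Implicit Types (r s t u : S) (e f : idem S) (k : R[i]) (x y : X) (z w b c : CA W).

(** A character of the Banach algebra [A_e] is contractive: if [ev x a = 1]
    and [|a| < 1] then [y = a + a y] has a solution, whose value at [x] would
    exceed itself by one. *)
Lemma norm_ev x e (a : A (val e)) : `|ev x a| <= `|a|.
Proof.
rewrite real_leNgt ?normr_real//; apply/negP => lt_a.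
have a_gt0 : 0 < `|ev x a| by apply: le_lt_trans lt_a.
have a_neq0 : ev x a != 0 by rewrite -normr_gt0.
have evZ k (d : A (val e)) : ev x (k *: d) = k * ev x d.
  by rewrite !evE embZ cvalZ//; apply: fibre_inCE; exact: fibre_emb.
pose d := (ev x a)^-1 *: a.
have evd : ev x d = 1 by rewrite evZ mulVf.
have [r r0 dr] := norm_realE d.
have r1 : r < 1.
  by rewrite -ltcR -dr normrZ normfV mulrC ltr_pdivrMr ?mul1r.
have ee : invle (val e * val e)%g (val e) by rewrite idemP invle_refl.
pose m (v : A (val e)) : A (val e) := fb_j A ee (fb_mul d v).
have ml : linear m by move=> k u v; rewrite /m fb_mul_linr linearP.
have mr v : `|m v| <= r%:C%C * `|v|.
  by rewrite /m fb_j_isom (le_trans (fb_norm_mul _ _))// dr.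
have [|y yE] := contraction_fixpoint d ml _ mr; first by rewrite r0.
have /esym/eqP : ev x y = 1 + ev x y.
  have eB (v : A (val e)) : inCE (emb v) by apply: fibre_inCE; exact: fibre_emb.
  rewrite {1}yE evE embD cvalD// -evE evd /m emb_j embM cvalM//.
  by rewrite -!evE evd mul1r.
by rewrite -subr_eq0 addrK oner_eq0.
Qed.

Hypothesis Asat : saturated A.

(** By saturation some product [b ⋅ c] with [b] over [s^*] and [c] over [s] does
    not vanish at [x]; by [nsq0_crossl] neither does [b^†], which lies over [s]. *)
Lemma Uopen_srcP s x : Uopen (src s) x <-> exists2 z, fibre s z & nsq x z != 0.
Proof.
split=> [[a a0]|[z zs z0]]; last first.
  by apply/UopenP; exists (z^† ⋅ z) => //; exact: fibre_src.
pose N : set (A (s^* * s)%g) := [set d | @ev _ _ _ W x (src s) d != 0].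
have evl : linear (@ev _ _ _ W x (src s) : A (s^* * s)%g -> R[i]^o).
  have eB (d : A (val (src s))) : inCE (emb d).
    by apply: fibre_inCE; exact: fibre_emb.
  move=> k u v; rewrite !evE embD embZ cvalD ?cvalZ//; exact: inCEZ.
have evc : continuous (@ev _ _ _ W x (src s) : A (s^* * s)%g -> R[i]^o).
  apply: (@bounded_continuous _ _ _ _ 1 _ evl) => // d; rewrite mul1r.
  exact: norm_ev.
have Nop : open N.
  have -> : N = (@ev _ _ _ W x (src s) : A (s^* * s)%g -> R[i]^o) @^-1` (~` [set 0]).
    by apply/seteqP; split=> d /= /eqP.
  apply: open_comp => [d _|]; first exact: evc.
  apply: closed_openC.
  exact/accessible_closed_set1/hausdorff_accessible/norm_hausdorff.
have [d [Nl [l dE]]] := @Asat _ _ N (ex_intro _ a a0) Nop.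
move: Nl; rewrite /N /= dE => Nl; apply: contrapT => H; move/negP: Nl; apply.
have {}H z : fibre s z -> nsq x z = 0.
  by move=> zs; apply/eqP/negP => /negP z0; apply: H; exists z.
elim: l {dE} => [|p l IH]; first by rewrite big_nil (linear_fun0 evl).
rewrite big_cons (linear_funD evl) (eqP IH) addr0 evE embM.
have ps : fibre s (emb p.1)^†.
  by apply: (fibre_eq (starK s)); apply: fibre_star; exact: fibre_emb.
rewrite -[emb p.1]cs_starK (nsq0_crossl Aab ps (fibre_emb _ _)) ?H//.
Qed.

Section ThetaExists.
Variables (s : S) (x : X) (w0 : CA W).
Hypotheses (w0s : fibre s w0) (w0x : nsq x w0 != 0).

(* the character [theta s x] *)
Let chi (d : CE W) : R[i]^o := cval x (w0^† ⋅ incl d ⋅ w0) / nsq x w0.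

Let inCE_incl (d : CE W) : inCE (incl d). Proof. by exists d. Qed.

Let chi_char : is_character chi.
Proof.
have iB (d : CE W) : inCE (w0^† ⋅ incl d ⋅ w0) by exact: (inCE_conj w0s).
have inclL : linear (@incl _ _ _ W) := @incl_linear _ _ _ W.
have chil : linear chi.
  move=> k d d'; rewrite /chi inclL csmulDr csmulDl csmulZr csmulZl.
  rewrite cvalD ?cvalZ//; last exact: inCEZ.
  by rewrite mulrDl -mulrA.
split=> //.
- move=> d d'; have /(congr1 (cval x)) := sandwich_mul Aab w0s (inCE_incl d) (inCE_incl d').
  rewrite cvalM// [RHS]cvalM -?/(nsq x w0); last 2 first.
  + exact: (inCE_cross w0s w0s).
  + by apply: (inCE_conj w0s); exact: inCEM.
  by rewrite /chi incl_mul mulf_div => ->; field.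
- move=> d; rewrite /chi incl_star.
  suff: cval x (w0^† ⋅ (incl d)^† ⋅ w0) / nsq x w0 =
    Num.conj (cval x (w0^† ⋅ incl d ⋅ w0) / nsq x w0 : R[i]) by [].
  apply: (mulIf w0x); rewrite -{4}(nsq_real x w0s) -rmorphM !divfK//.
  rewrite -[RHS]/((cval x (w0^† ⋅ incl d ⋅ w0))^*) -cval_star//.
  by rewrite !cs_star_mul cs_starK cs_mulA.
- pose K := `|w0^†| * `|w0| / `|nsq x w0|.
  apply: (@bounded_continuous _ _ _ _ K _ chil) => [|d].
    by rewrite /K divr_ge0// mulr_ge0.
  rewrite /chi normrM normfV /K mulrAC ler_wpM2r ?invr_ge0//.
  have [c cE] := iB d; rewrite -cE cval_incl.
  rewrite (le_trans (char_le_norm _ (xchar x)))// -incl_norm cE.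
  rewrite mulrAC (le_trans (cs_norm_mul _ _))// ler_wpM2r//.
  by rewrite (le_trans (cs_norm_mul _ _))// incl_norm.
- have [c cE] := inCE_cross_star w0s w0s; exists c.
  have ww := inCE_cross w0s w0s.
  by rewrite /chi cE conj_crossE (cvalM x ww ww) !mulf_neq0// invr_eq0.
Qed.

Lemma theta_exists : exists y : X, forall z b, fibre s z -> inCE b ->
  cval x (z^† ⋅ b ⋅ z) = nsq x z * cval y b.
Proof.
exists (exist _ (chi : {ptws CE W -> R[i]^o}) (mem_set chi_char)) => z b zs bB.
have [c cE] := bB; rewrite -{2}cE cval_incl/= /chi cE mulrA.
apply: (canRL (mulfK w0x)).
rewrite -[LHS]cvalM; [|exact: (inCE_conj zs)|exact: (inCE_cross w0s w0s)].
rewrite (sandwich_swap Aab zs w0s bB) cvalM//.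
- exact: (inCE_cross zs zs).
- exact: (inCE_conj w0s).
Qed.
End ThetaExists.

(** The case [nsq x z = 0], which the definition of [theta] leaves out, holds
    because both sides vanish. *)
Lemma thetaP s x z b : Uopen (src s) x -> fibre s z -> inCE b ->
  cval x (z^† ⋅ b ⋅ z) = nsq x z * cval (theta s x) b.
Proof.
move=> /Uopen_srcP[w ws w0] zs bB; rewrite /theta; case: xgetP => [y _ yP|]; last first.
  have [y yP] := theta_exists ws w0.
  move=> /(_ y); case=> a _ b' c; rewrite /sandwich sqE -!cval_incl => ->.
  by apply: yP; [exact: fibre_emb|exists b'].
have [z0|z0] := eqVneq (nsq x z) 0.
  by rewrite z0 mul0r (cval_conj0 Aab zs bB z0).
have [a aE] := zs; have [b' bE] := bB; have [c cE] := inCE_conj zs bB.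
have az : dom a x by rewrite /dom/= sqE aE lt_neqAle eq_sym z0 (nsq_ge0 x zs).
have := yP a az b' c; rewrite /sandwich -!cval_incl sqE -[iA W _]/(emb a).
by rewrite aE bE cE; exact.
Qed.

Lemma theta_uniq s x y z : Uopen (src s) x -> fibre s z -> nsq x z != 0 ->
  (forall b, inCE b -> cval x (z^† ⋅ b ⋅ z) = nsq x z * cval y b) ->
  theta s x = y.
Proof.
move=> xs zs z0 yP; apply: cval_inj => b bB.
by apply: (mulfI z0); rewrite -thetaP// yP.
Qed.

End Characters.

(** * Topology of the complex numbers *)

Lemma fmap_ultra (T U : Type) (f : T -> U) (F : set_system T) :
  UltraFilter F -> UltraFilter (f @ F).
Proof.
move=> FU; split; first exact: fmap_proper_filter.
move=> G GP FG; apply/seteqP; split=> [P GP'|]; last exact: FG.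
have [//|nP] := in_ultra_setVsetC (f @^-1` P) FU.
have /FG/(filterI GP')/filter_ex[u []//] : (f @ F) (~` P) by [].
Qed.

Section ComplexTopology.
Variable R : realType.
Implicit Types (M : R) (z : R[i]).

Lemma Re_continuous : continuous (@complex.Re R : R[i]^o -> R).
Proof.
move=> z; apply/(@cvgrPdist_lt _ _ _ _ (nbhs_filter z)) => e e0.
apply/(@nbhs_ballP _ R[i]^o); exists e%:C%C => [|w]; first by rewrite /= ltcR.
rewrite -ball_normE/= => zw; rewrite -ltcR; apply: le_lt_trans zw.
by rewrite -raddfB; exact: normc_ge_Re.
Qed.

Lemma real_complex_continuous : continuous (@real_complex_def R (Phant R) : R -> R[i]^o).
Proof.
move=> z; apply/cvgrPdist_lt => e e0; apply/nbhs_ballP.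
have [e' eE] : exists e', e = e'%:C%C.
  by exists (complex.Re e); rewrite RRe_real// gtr0_real.
exists e' => [|w]; first by rewrite /= -ltcR -eE.
by rewrite /= => zw; rewrite -rmorphB normc_def/= expr0n addr0 sqrtr_sqr eE ltcR.
Qed.

(** A square instead of a disc: it is the continuous image of a compact rectangle. *)
Definition cbox (M : R) : set R[i]^o :=
  (fun p : R * R => (p.1)%:C%C + 'i * (p.2)%:C%C) @` (`[- M, M] `*` `[- M, M]).

Lemma compact_cbox M : compact (cbox M).
Proof.
apply: continuous_compact.
  apply: continuous_subspaceT => p; apply: cvgD.
    apply: (continuous_comp cvg_fst); exact: real_complex_continuous.
  apply: cvgMr; apply: (continuous_comp cvg_snd); exact: real_complex_continuous.
by apply: compact_setX; exact: segment_compact.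
Qed.

Lemma cbox_norm M z : cbox M z -> `|z| <= (M + M)%:C%C.
Proof.
move=> [[a b] /= []]; rewrite !in_itv/= -!ler_norml => aM bM <-.
rewrite (le_trans (ler_normD _ _))// rmorphD/= lerD//.
  by rewrite normc_def/= expr0n addr0 sqrtr_sqr lecR.
by rewrite normrM normCi mul1r normc_def/= expr0n addr0 sqrtr_sqr lecR.
Qed.

Lemma norm_cbox M z : `|z| <= M%:C%C -> cbox M z.
Proof.
move=> zM; exists (complex.Re z, complex.Im z) => /=; last by rewrite -complexE.
split; rewrite /= in_itv/= -ler_norml -lecR; apply: le_trans zM.
  exact: normc_ge_Re.
by rewrite -normrN -ReiNIm -(mul1r `|z|) -(@normCi R[i]) -normrM mulrC; exact: normc_ge_Re.
Qed.

Lemma conjC_cvg (T : Type) (F : set_system T) (g : T -> R[i]^o) (l : R[i]^o) :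
  Filter F -> g @ F --> l ->
  (fun i => Num.conj (g i : R[i]) : R[i]^o) @ F --> (Num.conj (l : R[i]) : R[i]^o).
Proof.
move=> FF /cvgrPdist_lt gl; apply/cvgrPdist_lt => e e0; near=> i.
rewrite -[_ - _]/((l : R[i])^* - (g i : R[i])^*) -rmorphB norm_conjC.
by near: i; exact: gl.
Unshelve. all: by end_near. Qed.

Lemma Re_normE z : (complex.Re `|z|)%:C%C = `|z|.
Proof. by rewrite RRe_real// normr_real. Qed.

Lemma cvg_Re_norm (T : Type) (F : set_system T) (q : T -> R[i]^o) (l : R[i]^o) :
  Filter F -> q @ F --> l <-> (fun i => complex.Re `|q i - l|) @ F --> (0 : R).
Proof.
move=> FF; split=> [ql|ql].
  have H : (fun i => `|q i - l| : R[i]^o) @ F --> (`|l - l| : R[i]^o).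
    by apply: cvg_norm; apply: cvgB => //; exact: cvg_cst.
  have := cvg_comp _ _ H (@Re_continuous `|l - l|).
  by rewrite subrr normr0.
apply/cvgrPdist_lt => e e0.
have eE : e = (complex.Re e)%:C%C by rewrite RRe_real// gtr0_real.
have e'0 : 0 < complex.Re e by rewrite -ltcR -eE.
have /cvgrPdist_lt/(_ _ e'0) := ql; apply: filterS => i.
rewrite sub0r normrN -ltcR -eE distrC => H; apply: le_lt_trans H.
have n0 : 0 <= complex.Re `|l - q i| by rewrite -ler0c Re_normE.
by rewrite (ger0_norm n0) Re_normE.
Qed.

End ComplexTopology.

(** * The action on the spectrum, and the topology of the spectrum *)

Section ThetaAction.
Variables (R : realType) (S : invSemigroupType) (A : fellBundle R S).
Hypothesis Aab : semi_abelian A.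
Hypothesis Asat : saturated A.
Variable W : envelopes A.
Local Notation X := (spectrum (CE W)).
Local Notation emb := (@emb R S A W).
Local Notation fibre := (@fibre R S A W).
Local Notation inCE := (@inCE R S A W).
Local Notation Uopen := (@Uopen R S A W).
Local Notation theta := (@theta R S A W).
Implicit Types (r s t u : S) (e f : idem S) (k : R[i]) (x y : X) (z w b c : CA W).

Lemma Uopen_le e f x : invle (val e) (val f) -> Uopen e x -> Uopen f x.
Proof.
by move=> ef /UopenP[z ze z0]; apply/UopenP; exists z => //; exact: fibre_le ze.
Qed.

Lemma Uopen_eq e f x : val e = val f -> Uopen e x -> Uopen f x.
Proof. by move=> ef; apply: Uopen_le; rewrite ef invle_refl. Qed.

Lemma Uopen_mul e f x : Uopen (idem_mul e f) x <-> Uopen e x /\ Uopen f x.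
Proof.
split=> [ef|[/UopenP[z ze z0] /UopenP[w wf w0]]].
  split; apply: Uopen_le ef; [exact: invle_mulr|exact: invle_mull].
apply/UopenP; exists (z ⋅ w); first exact: fibreM.
by rewrite cvalM ?mulf_neq0//; [exact: fibre_inCE ze|exact: fibre_inCE wf].
Qed.

Lemma Uopen_srcM s e x :
  Uopen (src (s * val e)%g) x <-> Uopen (src s) x /\ Uopen e x.
Proof.
by rewrite -Uopen_mul; split; apply: Uopen_eq; rewrite src_mulr.
Qed.

Lemma Uopen_src_le s t x : invle s t -> Uopen (src s) x -> Uopen (src t) x.
Proof. by move=> st; apply: Uopen_le; exact: invle_src. Qed.

Lemma Uopen_unit e x : Uopen e x -> exists2 b, fibre (val e) b & cval x b = 1.
Proof.
move=> /UopenP[b be b0]; exists ((cval x b)^-1 *: b); first exact: fibreZ.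
by rewrite cvalZ ?mulVf//; exact: fibre_inCE be.
Qed.

(** For [w] over [s] not vanishing at [x], compute the value of
    [w^† ⋅ (z ⋅ z^†) ⋅ w] at [x] with [thetaP] and with [nsq_cross]. *)
Lemma nsq_theta_star s x z : Uopen (src s) x -> fibre s z ->
  nsq (theta s x) z^† = nsq x z.
Proof.
move=> xs zs; have /(Uopen_srcP Aab Asat _ _)[w ws w0] := xs.
apply: (mulfI w0); rewrite /nsq cs_starK.
rewrite -(thetaP Aab Asat xs ws (inCE_cross_star zs zs)).
rewrite conj_crossE cvalM; last 2 first.
- exact: (inCE_cross ws zs).
- exact: (inCE_cross zs ws).
by rewrite (cval_cross_conj x zs ws) -normCKC (nsq_cross Aab x zs ws) mulrC.
Qed.

Lemma nsq_theta_mul r s x z w : Uopen (src s) x -> fibre s z -> fibre r w ->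
  nsq x (w ⋅ z) = nsq x z * nsq (theta s x) w.
Proof.
move=> xs zs wr; rewrite /nsq cs_star_mul cs_mulA -(cs_mulA z^†).
exact: (thetaP Aab Asat xs zs (inCE_cross wr wr)).
Qed.

Lemma theta_dom s x : Uopen (src s) x -> Uopen (src s^*%g) (theta s x).
Proof.
move=> xs; have /(Uopen_srcP Aab Asat _ _)[z zs z0] := xs.
apply/(Uopen_srcP Aab Asat _ _); exists z^†; first exact: fibre_star.
by rewrite nsq_theta_star.
Qed.

(** If [d] over [s t] and [w] over [t] do not vanish at [y], then [d ⋅ w^†], which
    lies over [s], does not vanish at [theta t y]. *)
Lemma Uopen_src_mul s t y :
  Uopen (src (s * t)%g) y <-> Uopen (src t) y /\ Uopen (src s) (theta t y).
Proof.
split=> [yst|[yt ys]]; last first.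
  have /(Uopen_srcP Aab Asat _ _)[w wt w0] := yt.
  have /(Uopen_srcP Aab Asat _ _)[z zs z0] := ys.
  apply/(Uopen_srcP Aab Asat _ _); exists (z ⋅ w); first exact: fibreM.
  by rewrite (nsq_theta_mul yt wt zs) mulf_neq0.
have yt : Uopen (src t) y.
  apply: Uopen_le yst; rewrite val_src starM -mulgA (mulgA s^*%g).
  by rewrite -val_src -mul_conj_idem mulgA; exact: invle_mulr.
split=> //; have /(Uopen_srcP Aab Asat _ _)[w wt w0] := yt.
have /(Uopen_srcP Aab Asat _ _)[d dst d0] := yst.
apply/(Uopen_srcP Aab Asat _ _); exists (d ⋅ w^†).
  apply: (@fibre_le _ _ _ _ (s * t * t^*)%g).
    by rewrite -mulgA -val_src_star; exact: invle_mulr.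
  by apply: fibreM => //; exact: fibre_star.
have H : fibre (s * t * t^*)%g (d ⋅ w^†).
  by apply: fibreM => //; exact: fibre_star.
(* [d ⋅ w^† ⋅ w] does not vanish at [y] since neither [d] nor [w^† ⋅ w] does *)
have wwB := inCE_cross wt wt.
suff : nsq y (d ⋅ w^† ⋅ w) != 0.
  by rewrite (nsq_theta_mul yt wt H) mulf_eq0 negb_or => /andP[].
rewrite -cs_mulA (nsqMr y dst wwB) mulf_neq0//.
by rewrite expf_neq0// normr_eq0.
Qed.

Lemma thetaM s t y : Uopen (src t) y -> Uopen (src s) (theta t y) ->
  theta (s * t)%g y = theta s (theta t y).
Proof.
move=> yt ys; have /(Uopen_srcP Aab Asat _ _)[w wt w0] := yt.
have /(Uopen_srcP Aab Asat _ _)[z zs z0] := ys.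
have zw : nsq y (z ⋅ w) != 0 by rewrite (nsq_theta_mul yt wt zs) mulf_neq0.
apply: (theta_uniq Aab Asat _ (fibreM zs wt) zw); first exact/Uopen_src_mul.
move=> b bB; rewrite (nsq_theta_mul yt wt zs).
rewrite -mulrA -(thetaP Aab Asat ys zs bB) -(thetaP Aab Asat yt wt (inCE_conj zs bB)).
by rewrite cs_star_mul !cs_mulA.
Qed.

Lemma theta_idem e x : Uopen e x -> theta (val e) x = x.
Proof.
move=> xe; have /UopenP[z ze z0] := xe; have zB := fibre_inCE ze.
have zz : nsq x z = (cval x z)^* * cval x z.
  by rewrite /nsq cvalM// ?cval_star//; exact: inCE_star.
apply: (theta_uniq Aab Asat _ ze); first by rewrite src_idem.
  by rewrite zz mulf_neq0// conjC_eq0.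
move=> b bB; rewrite cvalM//; last by apply: inCEM => //; exact: inCE_star.
by rewrite cvalM// ?cval_star// ?zz; [rewrite mulrAC|exact: inCE_star].
Qed.

Lemma theta_le r s x : invle r s -> Uopen (src r) x -> theta r x = theta s x.
Proof.
move=> rs xr; have /(Uopen_srcP Aab Asat _ _)[z zr z0] := xr.
apply: (theta_uniq Aab Asat xr zr z0) => b bB.
by apply: (thetaP Aab Asat (Uopen_src_le rs xr)) => //; exact: fibre_le zr.
Qed.

Lemma thetaK s x : Uopen (src s) x -> theta s^*%g (theta s x) = x.
Proof.
by move=> xs; rewrite -thetaM//; [exact: (theta_idem xs)|exact: theta_dom].
Qed.

Lemma cval_continuous z : inCE z -> continuous ((fun x => cval x z) : X -> R[i]^o).
Proof.
move=> [c <-] x.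
have -> : (fun x => cval x (incl c)) =
    (fun f : {ptws CE W -> R[i]^o} => f c) \o val :> (X -> R[i]^o).
  by apply/funext => y /=; rewrite cval_incl.
apply: (@continuous_comp X {ptws CE W -> R[i]^o} R[i]^o).
  exact: initial_continuous.
exact: proj_continuous.
Qed.

Lemma spectrum_cvg (T : Type) (F : set_system T) (g : T -> X) x : Filter F ->
  (forall c : CE W, (fun i => cval (g i) (incl c) : R[i]^o) @ F --> (cval x (incl c) : R[i]^o)) ->
  g @ F --> x.
Proof.
move=> FF H.
have vF : (val \o g) @ F --> (val x : {ptws CE W -> R[i]^o}).
  apply/(@pointwise_cvgP (CE W) R[i]^o) => c /=; have := H c.
  by under eq_fun do rewrite cval_incl; rewrite cval_incl.
move=> P [_ [[V Vop <-] Vx VP]].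
apply: filterS VP _.
exact: (vF V (open_nbhs_nbhs (conj Vop Vx))).
Qed.

Lemma cval_neq0_open z : inCE z -> open [set x : X | cval x z != 0].
Proof.
move=> zB; have -> : [set x : X | cval x z != 0] =
    ((fun x => cval x z) : X -> R[i]^o) @^-1` (~` [set 0]).
  by apply/seteqP; split=> d /= /eqP.
apply: open_comp => [d _|]; first exact: cval_continuous.
apply: closed_openC.
exact/accessible_closed_set1/hausdorff_accessible/norm_hausdorff.
Qed.

Lemma Uopen_open e : open (Uopen e).
Proof.
have -> : Uopen e = \bigcup_(a : A (val e)) [set x : X | cval x (emb a) != 0].
  apply/seteqP; split=> x /= => [[a a0]|[a _ a0]]; exists a => //.
    by rewrite /= -evE.
  by rewrite evE.
apply: bigcup_open => a _; apply: cval_neq0_open.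
by apply: fibre_inCE; exact: fibre_emb.
Qed.

Lemma near_Uopen e x : Uopen e x -> \forall y \near x, Uopen e y.
Proof. by move=> xe; apply: open_nbhs_nbhs; split=> //; exact: Uopen_open. Qed.

(** Near [x] the value of [theta s y] at [c] is the quotient of the values at [y] of
    [z^† ⋅ c ⋅ z] and [z^† ⋅ z], for a fixed [z] not vanishing at [x]. *)
Lemma theta_continuous s x : Uopen (src s) x -> theta s @ x --> theta s x.
Proof.
move=> xs; have /(Uopen_srcP Aab Asat)[z zs z0] := xs.
apply: (@spectrum_cvg X (nbhs x) (theta s) _ (nbhs_filter x)) => c; have zz := inCE_cross zs zs.
have zcz : inCE (z^† ⋅ incl c ⋅ z) by apply: (inCE_conj zs); exists c.
have nz : \forall y \near x, Uopen (src s) y /\ nsq y z != 0.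
  apply: filterI; first exact: near_Uopen.
  by apply: open_nbhs_nbhs; split => //; exact: cval_neq0_open.
have thE y : Uopen (src s) y -> nsq y z != 0 ->
    cval (theta s y) (incl c) = cval y (z^† ⋅ incl c ⋅ z) / nsq y z.
  move=> ys y0; apply: (mulIf y0); rewrite divfK// mulrC; apply/esym.
  by apply: (thetaP Aab Asat ys zs); exists c.
rewrite (thE x)//; apply: cvg_trans.
  apply: near_eq_cvg; near=> y; symmetry; apply: thE; near: y.
  - by apply: filterS nz => y [].
  - by apply: filterS nz => y [].
apply: cvgM; first exact: (cval_continuous zcz).
by apply: cvgV => //; exact: (cval_continuous zz).
Unshelve. all: by end_near. Qed.

Lemma spectrum_hausdorff : hausdorff_space X.
Proof.
move=> x y xy; apply: cval_inj => z zB.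
apply: (@norm_hausdorff _ R[i]^o) => P Q Px Qy.
have [v [Pv Qv]] := xy _ _ (cval_continuous zB Px) (cval_continuous zB Qy).
by exists (cval v z).
Qed.

(** Around [x] take the characters [y] with [Re (y c) >= 1/2], where [x c = 1].  An
    ultrafilter on this set converges pointwise, since the values at each element
    stay in a compact square; the bound excludes the zero functional as limit. *)
Lemma spectrum_locally_compact : locally_compact [set: X].
Proof.
move=> x _; have [c0 c0x] := char_neq0 (xchar x).
pose c := (val x c0)^-1 *: c0.
have xc : val x c = 1.
  by rewrite (linear_funZ (char_linear (xchar x))) -[LHS]/(_ * _) mulVf.
pose rc (y : X) : R := complex.Re (cval y (incl c)).
have rc_cont : continuous rc.
  move=> y; apply: (@continuous_comp X R[i]^o R); last exact: Re_continuous.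
  by apply: cval_continuous; exists c.
pose K := rc @^-1` [set r | 1 / 2 <= r].
have Kcl : closed K by apply: closed_comp => [y _|]; [exact: rc_cont|exact: closed_ge].
exists K; last split=> //.
  apply: (@filterS _ (nbhs x) _ (rc @^-1` [set r | 1 / 2 < r])).
    by move=> y /ltW + _.
  apply: rc_cont; apply: open_nbhs_nbhs; split; first exact: open_gt.
  rewrite /= /rc cval_incl xc /= ltr_pdivrMr// mul1r.
  by rewrite (_ : 2 = 1 + 1 :> R)// ltrDl.
rewrite compact_ultra => F FU FK.
have FF : ProperFilter F  by exact: ultra_proper.
have lim_ex d : exists l : R[i]^o, (fun y => cval y (incl d) : R[i]^o) @ F --> l /\
    `|l| <= 2 * `|d|.
  have [M M0 dM] := norm_realE d.
  have : UltraFilter ((fun y => cval y (incl d) : R[i]^o) @ F) by exact: fmap_ultra.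
  have := @compact_cbox R M; rewrite compact_ultra => H /H[].
    apply: (@filterE _ F) => y; apply: norm_cbox.
    by rewrite /= cval_incl -dM; exact: char_le_norm (xchar y).
  by move=> l [/cbox_norm lM lF]; exists l; rewrite dM mulrDl mul1r -rmorphD.
have [f /all_and2[fP fM]] := choice lim_ex.
have uniq (g h : X -> R[i]^o) (l m : R[i]^o) : (forall y, g y = h y) ->
    g @ F --> l -> h @ F --> m -> l = m.
  move=> gh gl; have <- : g = h by exact/funext.
  exact: (@cvg_unique _ (@norm_hausdorff _ R[i]^o)).
have inclL : linear (@incl _ _ _ W) := @incl_linear _ _ _ W.
have fl : linear f.
  move=> k a b; apply: (uniq _ _ _ _ _ (fP _)); last first.
    by apply: cvgD (fP b); apply: cvgZr; exact: fP.
  move=> y; rewrite -[RHS]/(k * cval y (incl a) + cval y (incl b)) !cval_incl.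
  exact: (char_linear (xchar y)).
have fchar : is_character f.
  split=> //.
  - move=> a b; apply: (uniq _ _ _ _ _ (fP _)); last exact: cvgM (fP a) (fP b).
    move=> y; rewrite -[RHS]/(cval y (incl a) * cval y (incl b)) !cval_incl.
    exact: (char_mul (xchar y)).
  - move=> a; have FF' : Filter F by exact: filter_filter.
    have fa := conjC_cvg FF' (fP a).
    apply: (uniq _ _ _ _ _ (fP _) fa) => y; rewrite !cval_incl.
    exact: (char_star (xchar y)).
  - exact: (@bounded_continuous _ _ _ _ 2 (ler0n _ 2) fl fM).
  - exists c; apply/negP => /eqP fc0.
    have : 1 / 2 <= complex.Re (f c).
      have Fc : rc @ F --> complex.Re (f c).
        by apply: (cvg_comp _ _ (fP c)); exact: Re_continuous.
      apply: (@closed_ge R (1 / 2)) => B /Fc FB.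
      by have [y [Ky By]] := @filter_ex _ F _ _ (filterI FK FB); exists (rc y).
    by rewrite fc0 /= leNgt divr_gt0.
pose y : X := exist _ (f : {ptws CE W -> R[i]^o}) (mem_set fchar).
have Fy : F --> y.
  apply: (@spectrum_cvg X F id y FF) => a; rewrite cval_incl; exact: fP.
exists y; split => //; apply: Kcl => V Vy.
by apply: (@filter_ex _ F); apply: filterI => //; exact: Fy.
Qed.

End ThetaAction.

(** * The groupoid of germs *)

Section Germs.
Variables (R : realType) (S : invSemigroupType) (A : fellBundle R S).
Hypothesis Aab : semi_abelian A.
Hypothesis Asat : saturated A.
Variable W : envelopes A.
Local Notation X := (spectrum (CE W)).
Local Notation G := (germ W).
Local Notation Uopen := (@Uopen R S A W).
Local Notation theta := (@theta R S A W).
Local Notation K := (germ_groupoid W).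
Implicit Types (r s t u : S) (e f : idem S) (x y : X) (g h : G).

Lemma is_germ_dom g s x : is_germ g s x -> Uopen (src s) x.
Proof. by case. Qed.

Lemma mk_germP s x (h : Uopen (src s) x) : is_germ (mk_germ h) s x.
Proof. by []. Qed.

Lemma germ_ex g : exists s x, is_germ g s x.
Proof. by case: g => c [[s x] [h cE]]; exists s, x. Qed.

Lemma germ_uniq g h s x : is_germ g s x -> is_germ h s x -> g = h.
Proof.
by move=> [_ gE] [_ hE]; apply: eq_sig_hprop => [c|]; [exact: Prop_irrelevance|rewrite gE hE].
Qed.

(** Equality of germs is expressed by a common restriction [r] instead of an
    idempotent, since restrictions are compatible with products and adjoints. *)
Lemma is_germ_common g s x t y : is_germ g s x -> is_germ g t y ->
  x = y /\ exists r, [/\ invle r s, invle r t & Uopen (src r) x].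
Proof.
move=> [xs gs] [yt gt].
have : germ_class t y (t, y) by split=> //; split=> //; exists (src t).
rewrite -gt gs => -[_ [/= xy [e xe se]]]; split=> //.
exists (s * val e)%g; split; first exact: invle_mulr.
  by rewrite se; exact: invle_mulr.
exact/Uopen_srcM.
Qed.

Lemma germ_class_le s t x : invle t s -> Uopen (src t) x ->
  germ_class t x = germ_class s x :> set (S * X).
Proof.
move=> ts xt; have tE := mul_src_le ts; have xs := Uopen_src_le ts xt.
have tsrc e : (s * (val (src t) * val e) = t * val e)%g by rewrite mulgA tE.
have ttsrc e : (t * (val (src t) * val e) = t * val e)%g by rewrite mulgA mul_src.
apply/seteqP; split=> -[q y] [/= yq [xy [e xe E]]]; subst y;
  split=> //; split=> //=; exists (idem_mul (src t) e); rewrite ?Uopen_mul//.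
- rewrite -[LHS]/(s * (val (src t) * val e))%g tsrc.
  by rewrite -[RHS]/(q * (val (src t) * val e))%g idemC mulgA -E -mulgA -idemC ttsrc.
- rewrite -[LHS]/(t * (val (src t) * val e))%g ttsrc.
  by rewrite -[RHS]/(q * (val (src t) * val e))%g idemC mulgA -E -mulgA -idemC tsrc.
Qed.

Lemma is_germ_le g s t x : invle t s -> Uopen (src t) x ->
  is_germ g t x <-> is_germ g s x.
Proof.
move=> ts xt; have xs := Uopen_src_le ts xt.
by rewrite /is_germ (germ_class_le ts xt); split=> -[].
Qed.

Lemma germ_repP g : is_germ g (germ_rep g).1 (germ_rep g).2.
Proof. by rewrite /germ_rep; case: cid => p []. Qed.

Lemma germ_srcE g s x : is_germ g s x -> germ_src g = x.
Proof. by move=> /(is_germ_common (germ_repP g))[]. Qed.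

Lemma theta_germ g s x t y : is_germ g s x -> is_germ g t y -> theta s x = theta t y.
Proof.
move=> gs gt; have [<- [r [rs rt xr]]] := is_germ_common gs gt.
by rewrite -(theta_le Aab Asat rs xr) (theta_le Aab Asat rt xr).
Qed.

Lemma germ_rngE g s x : is_germ g s x -> germ_rng g = theta s x.
Proof. exact: theta_germ (germ_repP g). Qed.

Lemma germ_unitP e x : Uopen e x -> is_germ (germ_unit x) (val e) x.
Proof.
move=> xe; rewrite /germ_unit; case: cid => f xf.
have ef : Uopen (src (val (idem_mul e f))) x by rewrite src_idem Uopen_mul.
apply/(is_germ_le _ (invle_mulr (val e) f) ef).
by apply/(is_germ_le _ (invle_mull (val f) e) ef); exact: mk_germP.
Qed.

Lemma germ_mulP g h s x t y : is_germ g s x -> is_germ h t y -> theta t y = x ->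
  is_germ (germ_mul g h) (s * t)%g y.
Proof.
move=> gs ht tx; have xs := is_germ_dom gs; have yt := is_germ_dom ht.
have yst : Uopen (src (s * t)%g) y by apply/(Uopen_src_mul Aab Asat); rewrite tx.
rewrite /germ_mul; case: xgetP => [k _ [s' [x' [t' [y' [gs' ht' tx' kst]]]]]|]; last first.
  move=> /(_ (mk_germ yst)); case; exists s, x, t, y; split=> //; exact: mk_germP.
have [xx [r [rs rs' xr]]] := is_germ_common gs gs'.
have [yy [q [qt qt' yq]]] := is_germ_common ht ht'; subst x' y'.
have yrq : Uopen (src (r * q)%g) y.
  by apply/(Uopen_src_mul Aab Asat); rewrite (theta_le Aab Asat qt)// tx.
by apply/(is_germ_le _ (invle_mul rs qt) yrq)/(is_germ_le _ (invle_mul rs' qt') yrq).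
Qed.

Lemma germ_invP g s x : is_germ g s x -> is_germ (germ_inv g) s^*%g (theta s x).
Proof.
move=> gs; have xs := is_germ_dom gs.
rewrite /germ_inv; case: xgetP => [k _ [s' [x' [gs' ks]]]|]; last first.
  move=> /(_ (mk_germ (theta_dom Aab Asat xs))); case; exists s, x; split=> //.
  exact: mk_germP.
have [xx [r [rs rs' xr]]] := is_germ_common gs gs'; subst x'.
have xr' := theta_dom Aab Asat xr.
rewrite (theta_le Aab Asat rs)// in xr'.
move: ks; rewrite -(theta_germ gs gs') => ks.
by apply/(is_germ_le _ (invle_star rs) xr')/(is_germ_le _ (invle_star rs') xr').
Qed.

Lemma composableP g h s x t y : is_germ g s x -> is_germ h t y ->
  composable K g h <-> theta t y = x.
Proof.
by move=> gs ht; rewrite /composable/= (germ_srcE gs) (germ_rngE ht); split=> ->.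
Qed.

Lemma germ_is_groupoid : is_groupoid K.
Proof.
split=> /=.
- move=> x; have [e xe] := Uopen_cover x.
  by rewrite (germ_srcE (germ_unitP xe)).
- move=> x; have [e xe] := Uopen_cover x.
  by rewrite (germ_rngE (germ_unitP xe)) (theta_idem Aab Asat).
- move=> g h; have [s [x gs]] := germ_ex g; have [t [y ht]] := germ_ex h.
  by move=> /(composableP gs ht) /(germ_mulP gs ht) /germ_srcE ->; rewrite (germ_srcE ht).
- move=> g h; have [s [x gs]] := germ_ex g; have [t [y ht]] := germ_ex h.
  move=> /(composableP gs ht) tx; have /germ_rngE -> := germ_mulP gs ht tx.
  have xs := is_germ_dom gs; rewrite -tx in xs.
  by rewrite (thetaM Aab Asat (is_germ_dom ht) xs) tx (germ_rngE gs).
- move=> g h k; have [s [x gs]] := germ_ex g; have [t [y ht]] := germ_ex h.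
  have [u [z ku]] := germ_ex k.
  move=> /(composableP gs ht) tx /(composableP ht ku) uy.
  have hk := germ_mulP ht ku uy; have gh := germ_mulP gs ht tx.
  have yt : Uopen (src t) (theta u z) by rewrite uy; exact: is_germ_dom ht.
  have k1 := germ_mulP gh ku uy; rewrite -mulgA in k1; apply: germ_uniq k1.
  by apply: (germ_mulP gs hk); rewrite (thetaM Aab Asat (is_germ_dom ku) yt) uy.
- move=> g; have [s [x gs]] := germ_ex g; rewrite (germ_srcE gs).
  have xs := is_germ_dom gs; have ux := germ_unitP xs.
  have := germ_mulP gs ux (theta_idem Aab Asat xs).
  by rewrite mul_src => /germ_uniq; apply.
- move=> g; have [s [x gs]] := germ_ex g; rewrite (germ_rngE gs).
  have xs := theta_dom Aab Asat (is_germ_dom gs); have ux := germ_unitP xs.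
  have := germ_mulP ux gs erefl.
  by rewrite val_src_star mul_star_mul => /germ_uniq; apply.
- move=> g; have [s [x gs]] := germ_ex g.
  by rewrite (germ_srcE (germ_invP gs)) (germ_rngE gs).
- move=> g; have [s [x gs]] := germ_ex g.
  by rewrite (germ_rngE (germ_invP gs)) (germ_srcE gs) (thetaK Aab Asat (is_germ_dom gs)).
- move=> g; have [s [x gs]] := germ_ex g; rewrite (germ_rngE gs).
  have xs := theta_dom Aab Asat (is_germ_dom gs); have ux := germ_unitP xs.
  have := germ_mulP gs (germ_invP gs) (thetaK Aab Asat (is_germ_dom gs)).
  by rewrite -val_src_star => /germ_uniq; apply.
- move=> g; have [s [x gs]] := germ_ex g; rewrite (germ_srcE gs).
  have ux := germ_unitP (is_germ_dom gs).
  by have := germ_mulP (germ_invP gs) gs erefl => /germ_uniq; apply.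
Qed.

Lemma germ_open_open s (V : set X) : open V -> V `<=` Uopen (src s) ->
  open (germ_open s V : set G).
Proof.
move=> Vop Vs.
exists [set germ_open s V : set G]; last by rewrite bigcup_set1.
move=> _ ->; apply: (@finI_from1 _ _ _ id); by exists s, V.
Qed.

(** A finite intersection of subbasic sets [germ_open t V] containing [[s, x]]
    contains [[s, y]] for all [y] near [x], as [s] and [t] have a common
    restriction defined at [x]. *)
Lemma nbhs_germ g s x (P : set G) : is_germ g s x ->
  nbhs g P <-> \forall y \near x, forall h, is_germ h s y -> P h.
Proof.
move=> gs; have xs := is_germ_dom gs; split.
  rewrite nbhsE => -[B [[C CD <-] [Q CQ Qg]] BP].
  have [D [DD QE]] : exists D : {fset set G},
      (forall O, O \in D -> exists s V,
         [/\ open V, V `<=` Uopen (src s) & O = germ_open s V]) /\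
      \bigcap_(O in [set` D]) O = Q.
    by have [D DD QE] := CD _ CQ; exists D; split=> // O /DD; rewrite inE.
  have H O : O \in D -> \forall y \near x, forall h, is_germ h s y -> O h.
    move=> OD; have [t [V [Vop Vt OE]]] := DD _ OD.
    have : O g by move: Qg; rewrite /= -QE; exact.
    rewrite OE => -[x' Vx gt].
    have [xx [r [rs rt xr]]] := is_germ_common gs gt; subst x'.
    have := near_Uopen xr; have : nbhs x V by exact: open_nbhs_nbhs.
    apply: filterS2 => y Vy yr h hs; exists y => //.
    by apply/(is_germ_le _ rt yr)/(is_germ_le _ rs yr).
  have := @filter_bigI X (set G) D
    (fun O => [set y | forall h, is_germ h s y -> O h]) (nbhs x) (nbhs_filter x) H.
  apply: (@filterS _ (nbhs x) (nbhs_filter x)) => y Hy h hs.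
  apply: BP; exists Q => //; rewrite /= -QE => O OD; exact: (Hy _ OD).
rewrite nbhsE => -[V [Vop Vx] VP].
exists (germ_open s (V `&` Uopen (src s))).
  split; first by apply: germ_open_open => //; apply: openI => //; exact: Uopen_open.
  by exists x.
by move=> h [y [/VP H _]]; exact: H.
Qed.

Lemma germ_cvg (T : Type) (F : set_system T) (gamma : T -> G) g s x : Filter F ->
  is_germ g s x -> gamma @ F --> g <->
  (\forall i \near F, is_germ (gamma i) s (germ_src (gamma i))) /\
  (fun i => germ_src (gamma i)) @ F --> x.
Proof.
move=> FF gs; split=> [gF|[sF xF] P].
  split.
    suff : nbhs g [set h | is_germ h s (germ_src h)] by exact: gF.
    apply/(nbhs_germ _ gs); apply: (@filterE _ (nbhs x) (nbhs_filter x)) => y h hs.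
    by rewrite /= (germ_srcE hs).
  move=> V xV; suff : nbhs g [set h | V (germ_src h)] by exact: gF.
  apply/(nbhs_germ _ gs); apply: (@filterS _ (nbhs x) (nbhs_filter x)) xV => y Vy h hs.
  by rewrite /= (germ_srcE hs).
move=> /(nbhs_germ _ gs) H.
by apply: (@filterS2 _ F FF) sF (xF _ H) => i /= si; exact.
Qed.

Lemma germ_near g s x : is_germ g s x ->
  (\forall h \near g, is_germ h s (germ_src h)) /\ @germ_src R S A W @ g --> x.
Proof. by move=> gs; apply/(@germ_cvg G (nbhs g) id g s x (nbhs_filter g) gs). Qed.

Lemma germ_src_continuous : continuous (@germ_src R S A W).
Proof.
move=> g; have [s [x gs]] := germ_ex g; rewrite /continuous_at (germ_srcE gs).
exact: (germ_near gs).2.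
Qed.

Lemma theta_cvg (T : Type) (F : set_system T) (f : T -> X) s x :
  Uopen (src s) x -> f @ F --> x -> (fun i => theta s (f i)) @ F --> theta s x.
Proof. by move=> xs fx; exact: (cvg_comp _ _ fx (theta_continuous Aab Asat xs)). Qed.

Lemma germ_rng_continuous : continuous (@germ_rng R S A W).
Proof.
move=> g; have [s [x gs]] := germ_ex g; rewrite /continuous_at (germ_rngE gs).
have [sF xF] := germ_near gs.
apply: cvg_trans (theta_cvg (is_germ_dom gs) xF).
apply: (@near_eq_cvg _ _ (nbhs g) (nbhs_filter g)).
by apply: (@filterS _ (nbhs g) (nbhs_filter g)) sF => h /germ_rngE.
Qed.

Lemma germ_unit_continuous : continuous (@germ_unit R S A W).
Proof.
move=> x; have [e xe] := Uopen_cover x.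
apply/(@germ_cvg X (nbhs x) _ _ _ _ (nbhs_filter x) (germ_unitP xe)); split.
  apply: (@filterS _ (nbhs x) (nbhs_filter x)) (near_Uopen xe) => y /germ_unitP ye.
  by rewrite (germ_srcE ye).
rewrite (_ : (fun _ => _) = id)//; apply/funext => y.
exact: (g_src_unit germ_is_groupoid).
Qed.

Lemma germ_inv_continuous : continuous (@germ_inv R S A W).
Proof.
move=> g; have [s [x gs]] := germ_ex g; have [sF xF] := germ_near gs.
apply/(@germ_cvg G (nbhs g) _ _ _ _ (nbhs_filter g) (germ_invP gs)); split.
  apply: (@filterS _ (nbhs g) (nbhs_filter g)) sF => h /germ_invP hs.
  by rewrite (germ_srcE hs).
apply: cvg_trans (theta_cvg (is_germ_dom gs) xF).
apply: (@near_eq_cvg _ _ (nbhs g) (nbhs_filter g)).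
apply: (@filterS _ (nbhs g) (nbhs_filter g)) sF => h hs.
by rewrite (germ_srcE (germ_invP hs)).
Qed.

Lemma germ_mul_continuous : {within [set p : G * G | composable K p.1 p.2],
  continuous (fun p => germ_mul p.1 p.2)}.
Proof.
apply/subspace_continuousP => -[g h] /= gh.
have [s [x gs]] := germ_ex g; have [t [y ht]] := germ_ex h.
have tx := (composableP gs ht).1 gh.
set F := within _ _; have FF : Filter F by exact: within_filter.
have gF : (fun p : G * G => p.1) @ F --> g.
  by apply: cvg_trans (@cvg_fst _ _ (nbhs g) (nbhs h) _); exact: cvg_within_filter.
have hF : (fun p : G * G => p.2) @ F --> h.
  by apply: cvg_trans (@cvg_snd _ _ (nbhs g) (nbhs h) _); exact: cvg_within_filter.
have [sF xF] := (germ_cvg _ _ gs).1 gF; have [tF yF] := (germ_cvg _ _ ht).1 hF.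
have cF : \forall p \near F, composable K p.1 p.2 by exact: withinT.
have mF : \forall p \near F,
    is_germ (germ_mul p.1 p.2) (s * t)%g (germ_src p.2).
  apply: filterS3 sF tF cF => p ps pt pc; apply: (germ_mulP ps pt).
  exact: (composableP ps pt).1.
have mcvg : (fun p => germ_mul p.1 p.2) @ F --> germ_mul g h.
  apply/(germ_cvg _ _ (germ_mulP gs ht tx)); split.
    by apply: filterS mF => p ps; rewrite (germ_srcE ps).
  apply: cvg_trans yF; apply: near_eq_cvg; apply: filterS mF => p ps.
  by rewrite (germ_srcE ps).
exact: mcvg.
Qed.

Lemma germ_open_dom s x g : is_germ g s x ->
  open (germ_open s (Uopen (src s)) : set G) /\ germ_open s (Uopen (src s)) g.
Proof.
move=> gs; split; first by apply: germ_open_open => //; exact: Uopen_open.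
by exists x => //; exact: is_germ_dom gs.
Qed.

Lemma germ_src_local_homeo : local_homeomorphism (@germ_src R S A W).
Proof.
move=> g; have [s [x gs]] := germ_ex g.
have [Oop Og] := germ_open_dom gs.
exists (germ_open s (Uopen (src s))); split=> //.
- move=> h k /[!inE] -[y _ hs] [z _ ks]; rewrite (germ_srcE hs) (germ_srcE ks) => yz.
  by move: ks; rewrite -yz; exact: germ_uniq.
- by apply: continuous_subspaceT => ?; exact: germ_src_continuous.
- move=> V Vop VO; rewrite openE => _ [h Vh <-]; have [y ys hs] := VO _ Vh.
  have /(nbhs_germ _ hs) H : nbhs h V by exact: open_nbhs_nbhs.
  rewrite (germ_srcE hs); apply: (@filterS2 _ (nbhs y) (nbhs_filter y)) H (near_Uopen ys).
  move=> z Hz zs; exists (mk_germ zs); first by apply: Hz; exact: mk_germP.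
  exact: (germ_srcE (mk_germP zs)).
Qed.

(** The inverse of [[s, y] |-> theta s y] is induced by [theta s^*]. *)
Lemma germ_rng_local_homeo : local_homeomorphism (@germ_rng R S A W).
Proof.
move=> g; have [s [x gs]] := germ_ex g.
have [Oop Og] := germ_open_dom gs.
exists (germ_open s (Uopen (src s))); split=> //.
- move=> h k /[!inE] -[y ys hs] [z zs ks]; rewrite (germ_rngE hs) (germ_rngE ks) => yz.
  move: ks; rewrite -(thetaK Aab Asat zs) -yz (thetaK Aab Asat ys).
  exact: germ_uniq.
- by apply: continuous_subspaceT => ?; exact: germ_rng_continuous.
- move=> V Vop VO; rewrite openE => _ [h Vh <-]; have [y ys hs] := VO _ Vh.
  have /(nbhs_germ _ hs) H : nbhs h V by exact: open_nbhs_nbhs.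
  rewrite (germ_rngE hs); have tys := theta_dom Aab Asat ys.
  have := theta_continuous Aab Asat tys; rewrite (thetaK Aab Asat ys) => /(_ _ H) H'.
  apply: (@filterS2 _ _ (nbhs_filter (theta s y))) H' (near_Uopen tys) => z Hz zs.
  have zs' : Uopen (src s) (theta s^*%g z).
    by have := theta_dom Aab Asat zs; rewrite starK.
  exists (mk_germ zs'); first by apply: Hz; exact: mk_germP.
  rewrite (germ_rngE (mk_germP zs')).
  by have := thetaK Aab Asat zs; rewrite starK.
Qed.

Lemma germ_is_etale : is_etale_groupoid K.
Proof.
split.
- exact: germ_is_groupoid.
- exact: spectrum_hausdorff.
- exact: spectrum_locally_compact.
- exact: germ_unit_continuous.
- exact: germ_mul_continuous.
- exact: germ_inv_continuous.
- exact: germ_src_local_homeo.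
- exact: germ_rng_local_homeo.
Qed.
End Germs.

(** * Classes of triples and the operations on them *)

Section Lines.
Variables (R : realType) (S : invSemigroupType) (A : fellBundle R S).
Hypothesis Aab : semi_abelian A.
Hypothesis Asat : saturated A.
Variable W : envelopes A.
Local Notation X := (spectrum (CE W)).
Local Notation G := (germ W).
Local Notation L := (line W).
Local Notation emb := (@emb R S A W).
Local Notation fibre := (@fibre R S A W).
Local Notation inCE := (@inCE R S A W).
Local Notation Uopen := (@Uopen R S A W).
Local Notation theta := (@theta R S A W).
Implicit Types (r s t u : S) (e f : idem S) (x y : X) (g h : G) (v w : L).

Lemma line_classE s (a : A s) x t (b : A t) y :
  line_class a x (Tagged (fun s => (A s * X)%type) (b, y)) <->
  [/\ Uopen (src t) y, x = y & exists e z, [/\ fibre (val e) z, cval x z != 0,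
    (s * val e)%g = (t * val e)%g & nsq x (emb a ⋅ z - emb b ⋅ z) = 0]].
Proof.
split=> [[yt [xy [e [c [c0 [q [a' [b' [aE bE ab]]]]]]]]]|].
  split=> //; exists e, (emb c); rewrite -evE; split=> //; first exact: fibre_emb.
    by have /(congr1 tag)/= -> := aE; have /(congr1 tag)/= -> := bE.
  move: ab; rewrite sqE embB -(emb_eq _ aE) -(emb_eq _ bE).
  by rewrite !embM.
move=> [yt xy [e [z [[c cE] z0 se ab]]]]; split=> //; split=> //.
exists e, c; rewrite evE cE; split=> //=.
have [b' bE] : exists b' : A (s * val e)%g, delta (fb_mul b c) = delta b'.
  by rewrite se; exists (fb_mul b c).
exists (s * val e)%g, (fb_mul a c), b'; split=> //.
by rewrite sqE embB -(emb_eq _ bE) !embM cE.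
Qed.

Lemma nsq0_mulr x s z b : fibre s z -> inCE b -> nsq x z = 0 -> nsq x (z ⋅ b) = 0.
Proof. by move=> zs bB z0; rewrite (nsqMr x zs bB) z0 mulr0. Qed.

(** A witness [z] of equivalence with [a] is turned into one for [c], and
    conversely, by multiplying it with an element [w] over [r^* r] that takes the
    value one at [x]: then [a ⋅ (z ⋅ w)] and [c ⋅ (z ⋅ w)] agree at [x]. *)
Lemma line_class_le r s (a : A s) (c : A r) x : invle r s -> Uopen (src r) x ->
  nsq x (emb a - emb c) = 0 -> line_class a x = line_class c x.
Proof.
move=> rs xr ac; have /Uopen_unit[w wr w1] := xr.
have wB := fibre_inCE wr; have as' := fibre_emb W a.
have cs : fibre s (emb c) by apply: fibre_le rs _; exact: fibre_emb.
have w0 : cval x w != 0 by rewrite w1 oner_eq0.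
have rsrc e : (r * (val (src r) * val e) = r * val e)%g by rewrite mulgA mul_src.
have ssrc e : (s * (val (src r) * val e) = r * val e)%g by rewrite mulgA mul_src_le.
have fs e z : fibre (val e) z -> fibre s ((emb a - emb c) ⋅ (z ⋅ w)).
  move=> ze; apply: (fibre_le (invle_mulr s (idem_mul e (src r)))).
  by apply: fibreM; [exact: fibreB|exact: fibreM].
have ac0 e z : fibre (val e) z -> nsq x ((emb a - emb c) ⋅ (z ⋅ w)) = 0.
  move=> ze; apply: (nsq0_mulr (fibreB as' cs)) => //.
  by apply: inCEM => //; exact: fibre_inCE ze.
apply/seteqP; split=> -[q [d y]] /line_classE[/= xq xy [e [z [ze z0 se ad]]]];
  subst y; apply/line_classE; split=> //;
  have zB := fibre_inCE ze;
  exists (idem_mul e (src r)), (z ⋅ w); split; try exact: fibreM;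
  try (by rewrite cvalM// mulf_neq0);
  rewrite -1?[val (idem_mul _ _)]/(val e * val (src r))%g.
- by rewrite -idemC rsrc -ssrc idemC mulgA se -mulgA.
- have ads : fibre (s * val e)%g (emb a ⋅ z - emb d ⋅ z).
    apply: fibreB; first by apply: fibreM => //; exact: fibre_emb.
    by rewrite se; apply: fibreM => //; exact: fibre_emb.
  have -> : emb c ⋅ (z ⋅ w) - emb d ⋅ (z ⋅ w) =
     (emb a ⋅ z - emb d ⋅ z) ⋅ w - (emb a - emb c) ⋅ (z ⋅ w).
    by rewrite !csmulBl !cs_mulA opprB [RHS]addrC addrA subrK.
  apply: (@nsq0D _ _ _ Aab _ _ s).
  + apply: (fibre_le (invle_mulr s (idem_mul e (src r)))).
    rewrite -[val (idem_mul _ _)]/(val e * val (src r))%g mulgA.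
    by apply: fibreM.
  + by rewrite -scaleN1r; apply: fibreZ; exact: (fs e).
  + exact: nsq0_mulr ads wB ad.
  + by apply: (@nsq0N _ _ _ _ _ s); [exact: (fs e)|exact: (ac0 e)].
- by rewrite -idemC ssrc -rsrc idemC mulgA se -mulgA.
- have cds : fibre (r * val e)%g (emb c ⋅ z - emb d ⋅ z).
    apply: fibreB; first by apply: fibreM => //; exact: fibre_emb.
    by rewrite se; apply: fibreM => //; exact: fibre_emb.
  have -> : emb a ⋅ (z ⋅ w) - emb d ⋅ (z ⋅ w) =
     (emb c ⋅ z - emb d ⋅ z) ⋅ w + (emb a - emb c) ⋅ (z ⋅ w).
    by rewrite !csmulBl !cs_mulA [RHS]addrC addrA subrK.
  apply: (@nsq0D _ _ _ Aab _ _ s).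
  + apply: (@fibre_le _ _ _ _ (r * val e * val (src r))%g).
      by rewrite -mulgA; exact: invle_trans (invle_mulr r (idem_mul e (src r))) rs.
    by apply: fibreM.
  + exact: (fs e).
  + exact: nsq0_mulr cds wB ad.
  + exact: (ac0 e).
Qed.

Lemma is_line_dom v s (a : A s) x : is_line v a x -> Uopen (src s) x.
Proof. by case. Qed.

Lemma mk_lineP s (a : A s) x (h : Uopen (src s) x) : is_line (mk_line a h) a x.
Proof. by []. Qed.

Lemma line_ex v : exists s (a : A s) x, is_line v a x.
Proof. by case: v => c [[s [a x]] [h cE]]; exists s, a, x. Qed.

Lemma line_uniq v w s (a : A s) x : is_line v a x -> is_line w a x -> v = w.
Proof.
by move=> [_ vE] [_ wE]; apply: eq_sig_hprop => [c|]; [exact: Prop_irrelevance|rewrite vE wE].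
Qed.

Lemma is_line_tag v (u u' : {s : S & A s}) x : u = u' ->
  is_line v (tagged u) x -> is_line v (tagged u') x.
Proof. by move=> ->. Qed.

Lemma is_line_le v r s (a : A s) (c : A r) x : invle r s -> Uopen (src r) x ->
  nsq x (emb a - emb c) = 0 -> is_line v a x <-> is_line v c x.
Proof.
move=> rs xr ac; have xs := Uopen_src_le rs xr.
by rewrite /is_line (line_class_le rs xr ac); split=> -[].
Qed.

(** If [z] witnesses the equivalence, normalised by [cval x z = 1], the common
    restriction is [a ⋅ z], which agrees at [x] with [a], and with [b ⋅ z], hence
    with [b]. *)
Lemma is_line_common v s (a : A s) x t (b : A t) y :
  is_line v a x -> is_line v b y -> x = y /\ exists r (c : A r),
    [/\ invle r s, invle r t, Uopen (src r) x,
        nsq x (emb a - emb c) = 0 & nsq x (emb b - emb c) = 0].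
Proof.
move=> [xs va] [yt vb].
have : line_class b y (Tagged (fun s => (A s * X)%type) (b, y)).
  apply/line_classE; split=> //; have [w wt w1] := Uopen_unit yt.
  by exists (src t), w; split; rewrite // ?w1 ?oner_eq0// subrr /nsq csmul0r cval0.
rewrite -vb va => /line_classE[_ xy [e [z0 [z0e z00 se ab]]]]; subst y.
split=> //; pose z := (cval x z0)^-1 *: z0.
have ze : fibre (val e) z by exact: fibreZ.
have z1 : cval x z = 1 by rewrite cvalZ ?mulVf//; exact: fibre_inCE z0e.
have as' := fibre_emb W a; have bt := fibre_emb W b.
have abse : fibre (s * val e)%g (emb a ⋅ z0 - emb b ⋅ z0).
  by apply: fibreB; [|rewrite se]; exact: fibreM.
have xse : Uopen (src (s * val e)%g) x.
  apply/Uopen_srcM; split=> //; apply/UopenP; exists z0 => //.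
have [c cE] : fibre (s * val e)%g (emb a ⋅ z) by exact: fibreM.
exists (s * val e)%g, c; rewrite cE; split=> //.
- exact: invle_mulr.
- by rewrite se; exact: invle_mulr.
- exact: (nsq_subMr as' ze z1).
- have azt : fibre t (emb a ⋅ z).
    by apply: (fibre_le (invle_mulr t e)); rewrite -se; exact: fibreM.
  have bzt : fibre t (emb b ⋅ z).
    by apply: (fibre_le (invle_mulr t e)); exact: fibreM.
  apply: (nsq0_trans Aab bt bzt azt (nsq_subMr bt ze z1)).
  apply: (nsq0_sym azt bzt).
  by rewrite /z !csmulZr -scalerBr (nsqZ _ _ abse) ab mulr0.
Qed.

Lemma is_line_same v s (a b : A s) x : is_line v a x ->
  is_line v b x <-> nsq x (emb a - emb b) = 0.
Proof.
move=> va; have xs := is_line_dom va; split=> [vb|ab]; last first.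
  by apply/(is_line_le v (invle_refl s) xs ab).
have [_ [r [c [rs _ xr ac bc]]]] := is_line_common va vb.
have cs : fibre s (emb c) by apply: fibre_le rs _; exact: fibre_emb.
have as' := fibre_emb W a; have bs := fibre_emb W b.
by apply: (nsq0_trans Aab as' cs bs ac); exact: (nsq0_sym bs cs bc).
Qed.

Lemma line_repP v : is_line v (tagged (line_rep v)).1 (tagged (line_rep v)).2.
Proof. by rewrite /line_rep; case: cid => q [h]. Qed.

Lemma line_projP v s (a : A s) x : is_line v a x -> is_germ (line_proj v) s x.
Proof.
move=> va; have [xx [r [c [rs rt xr _ _]]]] := is_line_common va (line_repP v).
rewrite -(is_germ_le _ rs xr) (is_germ_le _ rt xr) [X in is_germ _ _ X]xx.
exact: mk_germP.
Qed.

Lemma line_norm_ge0 v : 0 <= line_norm v. Proof. exact: sqrtr_ge0. Qed.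

Lemma line_normE v s (a : A s) x : is_line v a x ->
  ((line_norm v) ^+ 2)%:C%C = nsq x (emb a).
Proof.
move=> va; have [xx [r [c [rs rt xr ac bc]]]] := is_line_common va (line_repP v).
have as' := fibre_emb W a; have bt := fibre_emb W (tagged (line_rep v)).1.
have cr := fibre_emb W c.
have -> : nsq x (emb a) = nsq x (emb (tagged (line_rep v)).1).
  rewrite (nsq0_eq Aab as' (fibre_le rs cr) ac).
  by rewrite (nsq0_eq Aab bt (fibre_le rt cr) bc).
have b0 := nsq_ge0 x bt; have := b0; rewrite lecE /= => /andP[_ re0].
by rewrite /line_norm sqE -xx sqr_sqrtr// RRe_real// ger0_real.
Qed.

(** An arbitrary representative is restricted to a fibre [A r] with [r <= s] and
    then carried into [A s] by the inclusion. *)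
Lemma line_rep_at v s x : is_germ (line_proj v) s x -> exists a : A s, is_line v a x.
Proof.
have [t [b [y vb]]] := line_ex v => gs.
have [xy [r [rs rt xr]]] := is_germ_common gs (line_projP vb); subst y.
have [z zr z1] := Uopen_unit xr; have bt := fibre_emb W b.
have [c cE] : fibre r (emb b ⋅ z).
  by apply: (fibre_eq (mul_src_le rt)); exact: fibreM.
have [a aE] : fibre s (emb b ⋅ z) by apply: fibre_le rs _; exists c.
exists a; apply/(is_line_le v rs xr (a := a) (c := c)).
  by rewrite aE cE subrr /nsq csmul0r cval0.
apply/(is_line_le v rt xr (a := b) (c := c)) => //.
by rewrite cE; exact: (nsq_subMr bt zr z1).
Qed.

Lemma line_rep_fibre v w s (b : A s) x : line_proj v = line_proj w ->
  is_line w b x -> exists a : A s, is_line v a x.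
Proof. by move=> vw /line_projP; rewrite -vw; exact: line_rep_at. Qed.

Lemma is_line_agree v s (a : A s) x t (b : A t) : is_line v a x -> is_line v b x ->
  exists e z, [/\ fibre (val e) z, cval x z = 1, (s * val e)%g = (t * val e)%g &
    nsq x (emb a ⋅ z - emb b ⋅ z) = 0].
Proof.
move=> va vb; have [_ [r [c [rs rt xr ac bc]]]] := is_line_common va vb.
have [z zr z1] := Uopen_unit xr; have zB := fibre_inCE zr.
have as' := fibre_emb W a; have bt := fibre_emb W b; have cr := fibre_emb W c.
exists (src r), z; split=> //; first by rewrite !mul_src_le.
have -> : emb a ⋅ z - emb b ⋅ z = (emb a - emb c) ⋅ z - (emb b - emb c) ⋅ z.
  by rewrite !csmulBl opprB addrA subrK.
have acs := fibreB as' (fibre_le rs cr); have bct := fibreB bt (fibre_le rt cr).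
apply: (@nsq0D _ _ _ Aab _ _ r).
- by apply: (fibre_eq (mul_src_le rs)); exact: fibreM.
- rewrite -scaleN1r; apply: fibreZ.
  by apply: (fibre_eq (mul_src_le rt)); exact: fibreM.
- exact: nsq0_mulr acs zB ac.
- apply: (@nsq0N _ _ _ _ _ t); last exact: nsq0_mulr bct zB bc.
  by apply: (fibre_le (invle_mulr t (src r))); exact: fibreM.
Qed.

(** The definition adds [a'] and [b'] over different elements [s'] and [t'] after
    multiplication with [c].  The element [p] carries both this [c] and the
    witnesses that [a'] agrees with [a] and [b'] with [b]. *)
Lemma line_addP v w s (a b : A s) x : is_line v a x -> is_line w b x ->
  is_line (line_add v w) (a + b) x.
Proof.
move=> va wb; have xs := is_line_dom va; rewrite /line_add; case: xgetP; last first.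
  have [_ [c <-] c1] := Uopen_unit xs.
  have xss : Uopen (src (s * val (src s))%g) x by rewrite Uopen_srcM.
  move=> /(_ (mk_line (fb_mul a c + fb_mul b c) xss)); case.
  exists s, a, s, b, x, (src s), c, (fb_mul b c); split=> //.
    by rewrite evE.
move=> u _ [s' [a' [t' [b' [y [e [c [d [va' wb' [ye c1] dE uad]]]]]]]]].
have [yx _] := is_line_common va va'; subst y.
have [e1 [z1 [ze1 z1x se1 aa]]] := is_line_agree va' va.
have [e2 [z2 [ze2 z2x se2 bb]]] := is_line_agree wb' wb.
have se : (s' * val e = t' * val e)%g by exact: (congr1 tag dE).
have {}dE : emb d = emb b' ⋅ emb c by rewrite (emb_eq W dE) embM.
rewrite evE in c1; have ce := fibre_emb W c.
have cB := fibre_inCE ce; have z1B := fibre_inCE ze1; have z2B := fibre_inCE ze2.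
have as' := fibre_emb W a'; have bt' := fibre_emb W b'.
pose f := idem_mul e (idem_mul e1 e2); pose p := emb c ⋅ (z1 ⋅ z2).
have fp : fibre (val f) p by apply: fibreM => //; exact: fibreM.
have p1 : cval x p = 1.
  by rewrite /p !cvalM ?c1 ?z1x ?z2x ?mul1r//; exact: inCEM.
have pz1 : p = z1 ⋅ (emb c ⋅ z2).
  by rewrite /p !cs_mulA (inCEC Aab cB z1B).
have pz2 : p = z2 ⋅ (emb c ⋅ z1).
  by rewrite /p (inCEC Aab z1B z2B) !cs_mulA (inCEC Aab cB z2B).
have sf : (s * val f = s' * val e * (val e1 * val e2))%g.
  have key : (val e * (val e1 * val e2) = val e1 * (val e * val e2))%g.
    by rewrite mulgA (idemC e e1) mulgA.
  by rewrite -[val f]/(val e * (val e1 * val e2))%g -(mulgA s') key !(mulgA _ (val e1)) se1.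
have sfe : invle (s * val f)%g (s' * val e)%g.
  by rewrite sf; exact: (invle_mulr _ (idem_mul e1 e2)).
have xf : Uopen (src (s * val f)%g) x.
  apply/Uopen_srcM; split=> //; apply/UopenP; exists p => //.
  by rewrite p1 oner_eq0.
have abs : fibre s (emb (a + b)) by exact: fibre_emb.
have [m mE] : fibre (s * val f)%g (emb (a + b) ⋅ p) by exact: fibreM.
apply/(is_line_le u (invle_mulr s f) xf (c := m)).
  by rewrite mE; exact: nsq_subMr abs fp p1.
apply/(is_line_le u sfe xf (a := fb_mul a' c + d)) => //.
rewrite mE !embD embM dE.
set q := emb a' ⋅ emb c + emb b' ⋅ emb c.
have qs : fibre (s' * val e)%g q.
  by apply: fibreD; [|rewrite se]; exact: fibreM.
have zz : fibre (val (idem_mul e1 e2)) (z1 ⋅ z2) by exact: fibreM.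
have zz1 : cval x (z1 ⋅ z2) = 1 by rewrite cvalM// z1x z2x mulr1.
have qzs : fibre (s' * val e)%g (q ⋅ (z1 ⋅ z2)).
  by apply: (fibre_le (invle_mulr _ (idem_mul e1 e2))); exact: fibreM.
have aps : fibre (s' * val e)%g ((emb a + emb b) ⋅ p).
  by apply: (fibre_le sfe); rewrite -embD; exact: fibreM.
apply: (nsq0_trans Aab qs qzs aps (nsq_subMr qs zz zz1)).
have -> : q ⋅ (z1 ⋅ z2) - (emb a + emb b) ⋅ p =
    (emb a' ⋅ z1 - emb a ⋅ z1) ⋅ (emb c ⋅ z2) +
    (emb b' ⋅ z2 - emb b ⋅ z2) ⋅ (emb c ⋅ z1).
  rewrite !csmulBl -!(cs_mulA _ z1) -!(cs_mulA _ z2) -pz1 -pz2.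
  by rewrite /q !csmulDl -!cs_mulA -/p opprD addrACA.
have azs : fibre (s' * val e1)%g (emb a' ⋅ z1 - emb a ⋅ z1).
  by apply: fibreB; [|rewrite se1]; apply: fibreM => //; exact: fibre_emb.
have bzs : fibre (t' * val e2)%g (emb b' ⋅ z2 - emb b ⋅ z2).
  by apply: fibreB; [|rewrite se2]; apply: fibreM => //; exact: fibre_emb.
apply: (@nsq0D _ _ _ Aab _ _ (s' * val e)%g).
- apply: (fibre_le sfe); apply: (@fibre_eq _ _ _ _ (s' * val e1 * (val e * val e2))%g).
    by rewrite sf -!mulgA; congr (_ * _)%g; rewrite !mulgA idemC.
  by apply: fibreM => //; exact: fibreM.
- apply: (fibre_le sfe); apply: (@fibre_eq _ _ _ _ (t' * val e2 * (val e * val e1))%g).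
    rewrite sf se -!mulgA; congr (_ * _)%g.
    by rewrite (mulgA (val e2)) (idemC e2 e) -mulgA (idemC e2 e1).
  by apply: fibreM => //; exact: fibreM.
- by apply: nsq0_mulr azs _ aa; exact: inCEM.
- by apply: nsq0_mulr bzs _ bb; exact: inCEM.
Qed.

Lemma line_scaleP k v s (a : A s) x : is_line v a x ->
  is_line (line_scale k v) (k *: a) x.
Proof.
move=> va; rewrite /line_scale; case: xgetP => [w _ [t [b [y [vb wb]]]]|]; last first.
  move=> /(_ (mk_line (k *: a) (is_line_dom va))); case.
  by exists s, a, x; split=> //; exact: mk_lineP.
have [xy [r [c [rs rt xr ac bc]]]] := is_line_common va vb; subst y.
have cr := fibre_emb W c.
have H q (d : A q) : invle r q -> nsq x (emb d - emb c) = 0 ->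
    nsq x (emb (k *: d) - emb (k *: c)) = 0.
  move=> rq dc; rewrite !embZ -scalerBr (@nsqZ _ _ _ _ _ q) ?dc ?mulr0//.
  by apply: fibreB; [exact: fibre_emb|exact: fibre_le rq cr].
apply/(is_line_le w rs xr (H _ _ rs ac)).
by apply/(is_line_le w rt xr (H _ _ rt bc)).
Qed.

Lemma line_starP v s (a : A s) x : is_line v a x ->
  is_line (line_star v) (fb_star a) (theta s x).
Proof.
move=> va; have tx := theta_dom Aab Asat (is_line_dom va).
rewrite /line_star; case: xgetP => [w _ [t [b [y [vb wb]]]]|]; last first.
  move=> /(_ (mk_line (fb_star a) tx)); case.
  by exists s, a, x; split=> //; exact: mk_lineP.
have [xy [r [c [rs rt xr ac bc]]]] := is_line_common va vb; subst y.
have cr := fibre_emb W c.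
have txr : Uopen (src r^*%g) (theta s x).
  by rewrite -(theta_le Aab Asat rs xr); exact: theta_dom.
have H q (d : A q) : invle r q -> nsq x (emb d - emb c) = 0 ->
    nsq (theta s x) (emb (fb_star d) - emb (fb_star c)) = 0.
  move=> rq dc; rewrite !emb_star -csstarB -(theta_le Aab Asat rs xr).
  rewrite (theta_le Aab Asat rq xr) (nsq_theta_star Aab Asat (Uopen_src_le rq xr))//.
  by apply: fibreB; [exact: fibre_emb|exact: fibre_le rq cr].
rewrite -(theta_germ Aab Asat (line_projP va) (line_projP vb)) in wb.
apply/(is_line_le w (invle_star rs) txr (H _ _ rs ac)).
by apply/(is_line_le w (invle_star rt) txr (H _ _ rt bc)).
Qed.

(** The error [a1 b1 - c d] is split as [(a1 - c) b1 + c (b1 - d)]. *)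
Lemma line_mulP v w s (a : A s) x t (b : A t) y : is_line v a x ->
  is_line w b y -> theta t y = x -> is_line (line_mul v w) (fb_mul a b) y.
Proof.
move=> va wb tx; have xs := is_line_dom va; have yt := is_line_dom wb.
have yst : Uopen (src (s * t)%g) y by apply/(Uopen_src_mul Aab Asat); rewrite tx.
rewrite /line_mul; case: xgetP; last first.
  move=> /(_ (mk_line (fb_mul a b) yst)); case.
  by exists s, a, x, t, b, y; split=> //; exact: mk_lineP.
move=> u _ [s' [a' [x' [t' [b' [y' [va' wb' tx' uab]]]]]]].
have [xx [r [c [rs rs' xr ac ac']]]] := is_line_common va va'.
have [yy [q [d [qt qt' yq bd bd']]]] := is_line_common wb wb'; subst x' y'.
have cr := fibre_emb W c; have dq := fibre_emb W d.
have yrq : Uopen (src (r * q)%g) y.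
  by apply/(Uopen_src_mul Aab Asat); rewrite (theta_le Aab Asat qt)// tx.
have H p (a1 : A p) p' (b1 : A p') : invle r p -> invle q p' -> theta p' y = x ->
    nsq x (emb a1 - emb c) = 0 -> nsq y (emb b1 - emb d) = 0 ->
    nsq y (emb (fb_mul a1 b1) - emb (fb_mul c d)) = 0.
  move=> rp qp tp a1c b1d; have yp := Uopen_src_le qp yq.
  have a1p := fibre_emb W a1; have b1p := fibre_emb W b1.
  have a1cp := fibreB a1p (fibre_le rp cr); have b1dp := fibreB b1p (fibre_le qp dq).
  have -> : emb (fb_mul a1 b1) - emb (fb_mul c d) =
      (emb a1 - emb c) ⋅ emb b1 + emb c ⋅ (emb b1 - emb d).
    by rewrite !embM csmulBl csmulBr addrA subrK.
  apply: (@nsq0D _ _ _ Aab _ _ (p * p')%g).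
  - exact: fibreM.
  - by apply: fibreM => //; exact: fibre_le rp cr.
  - by rewrite (nsq_theta_mul Aab Asat yp b1p a1cp) tp a1c mulr0.
  - by rewrite (nsq_theta_mul Aab Asat yp b1dp (fibre_le rp cr)) b1d mul0r.
apply/(is_line_le u (invle_mul rs qt) yrq (H _ _ _ _ rs qt tx ac bd)).
by apply/(is_line_le u (invle_mul rs' qt') yrq (H _ _ _ _ rs' qt' (esym xx) ac' bd')).
Qed.

Lemma line_zeroP g s x : is_germ g s x -> is_line (line_zero g) (0 : A s) x.
Proof.
move=> gs; have gr := germ_repP g.
have [xx [r [rs rt xr]]] := is_germ_common gs gr.
have H q : nsq x (emb (0 : A q) - emb (0 : A r)) = 0.
  by rewrite !emb0 subrr /nsq csmul0r cval0.
apply/(is_line_le _ rs xr (H s))/(is_line_le _ rt xr (H (germ_rep g).1)).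
by rewrite xx; exact: mk_lineP.
Qed.

Lemma hatP s (a : A s) g x : is_germ g s x -> is_line (hat a g) a x.
Proof.
move=> gs; rewrite /hat; case: xgetP => [v _ [y [gs' va]]|]; last first.
  move=> /(_ (mk_line a (is_germ_dom gs))); case.
  by exists x; split=> //; exact: mk_lineP.
by have [-> _] := is_germ_common gs gs'.
Qed.
End Lines.

(** * The algebraic Fell bundle axioms *)

Section LineAlgebra.
Variables (R : realType) (S : invSemigroupType) (A : fellBundle R S).
Hypothesis Aab : semi_abelian A.
Hypothesis Asat : saturated A.
Variable W : envelopes A.
Local Notation X := (spectrum (CE W)).
Local Notation G := (germ W).
Local Notation L := (line W).
Local Notation emb := (@emb R S A W).
Local Notation fibre := (@fibre R S A W).
Local Notation Uopen := (@Uopen R S A W).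
Local Notation theta := (@theta R S A W).
Local Notation K := (germ_groupoid W).
Local Notation p := (@line_proj R S A W).
Local Notation comp v w := (composable K (p v) (p w)).
Local Notation sc := (@line_scale R S A W).
Local Notation ad := (@line_add R S A W).
Local Notation N := (@line_norm R S A W).
Local Notation mul := (@line_mul R S A W).
Local Notation star := (@line_star R S A W).
Implicit Types (r s t : S) (e f : idem S) (x y : X) (g h : G) (u v w : L) (k : R[i]).

Lemma line_compP v w s (a : A s) x t (b : A t) y : is_line v a x -> is_line w b y ->
  comp v w <-> theta t y = x.
Proof.
move=> va wb; exact: composableP (line_projP Aab va) (line_projP Aab wb).
Qed.

Lemma line_mul_proj v w : comp v w -> p (mul v w) = germ_mul (p v) (p w).
Proof.
have [s [a [x va]]] := line_ex v; have [t [b [y wb]]] := line_ex w.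
move=> /(line_compP va wb) tx; apply: (germ_uniq (s := (s * t)%g) (x := y)).
  exact: line_projP (line_mulP Aab Asat va wb tx).
exact: (germ_mulP Aab Asat (line_projP Aab va) (line_projP Aab wb) tx).
Qed.

Lemma line_mulA u v w : comp u v -> comp v w -> mul u (mul v w) = mul (mul u v) w.
Proof.
have [s [a [x ua]]] := line_ex u; have [t [b [y vb]]] := line_ex v.
have [r [c [z wc]]] := line_ex w.
move=> /(line_compP ua vb) tx /(line_compP vb wc) ry.
have uv := line_mulP Aab Asat ua vb tx; have vw := line_mulP Aab Asat vb wc ry.
have ytr : Uopen (src t) (theta r z) by rewrite ry; exact: is_line_dom vb.
have uvw := line_mulP Aab Asat ua vw.
rewrite (thetaM Aab Asat (is_line_dom wc) ytr) ry in uvw.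
apply: line_uniq (line_mulP Aab Asat uv wc ry).
exact: is_line_tag (fb_mulA a b c) (uvw tx).
Qed.

Lemma line_mul_linl k u v w : p u = p v -> comp u w ->
  mul (ad (sc k u) v) w = ad (sc k (mul u w)) (mul v w).
Proof.
have [s [b [x vb]]] := line_ex v; have [t [c [y wc]]] := line_ex w.
move=> uv; have [a ua] := line_rep_fibre Aab uv vb.
move=> /(line_compP ua wc) tx.
have kuv := line_addP Aab (line_scaleP Aab k ua) vb.
have := line_mulP Aab Asat kuv wc tx; rewrite fb_mul_linl => /line_uniq; apply.
exact: (line_addP Aab (line_scaleP Aab k (line_mulP Aab Asat ua wc tx))
  (line_mulP Aab Asat vb wc tx)).
Qed.

Lemma line_mul_linr k u v w : comp u v -> p v = p w ->
  mul u (ad (sc k v) w) = ad (sc k (mul u v)) (mul u w).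
Proof.
have [s [a [x ua]]] := line_ex u; have [t [c [y wc]]] := line_ex w.
move=> + vw; have [b vb] := line_rep_fibre Aab vw wc.
move=> /(line_compP ua vb) tx.
have kvw := line_addP Aab (line_scaleP Aab k vb) wc.
have := line_mulP Aab Asat ua kvw tx; rewrite fb_mul_linr => /line_uniq; apply.
exact: (line_addP Aab (line_scaleP Aab k (line_mulP Aab Asat ua vb tx))
  (line_mulP Aab Asat ua wc tx)).
Qed.

Lemma line_star_proj v : p (star v) = germ_inv (p v).
Proof.
have [s [a [x va]]] := line_ex v.
apply: (germ_uniq (line_projP Aab (line_starP Aab Asat va))).
exact: (germ_invP Aab Asat (line_projP Aab va)).
Qed.

Lemma line_star_lin k v w : p v = p w ->
  star (ad (sc k v) w) = ad (sc k^* (star v)) (star w).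
Proof.
have [s [b [x wb]]] := line_ex w => vw; have [a va] := line_rep_fibre Aab vw wb.
have := line_starP Aab Asat (line_addP Aab (line_scaleP Aab k va) wb).
rewrite fb_star_lin => /line_uniq; apply.
exact: (line_addP Aab (line_scaleP Aab k^* (line_starP Aab Asat va))
  (line_starP Aab Asat wb)).
Qed.

Lemma line_norm_inj v (c : R) : 0 <= c -> (N v ^+ 2)%:C%C = (c ^+ 2)%:C%C -> N v = c.
Proof.
move=> c0 /complexI /eqP; rewrite eqrXn2 ?line_norm_ge0// => /eqP //.
Qed.

Lemma line_normM v w : comp v w -> N (mul v w) = N v * N w.
Proof.
have [s [a [x va]]] := line_ex v; have [t [b [y wb]]] := line_ex w.
move=> /(line_compP va wb) tx; apply: line_norm_inj.
  by rewrite mulr_ge0// line_norm_ge0.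
rewrite (line_normE Aab (line_mulP Aab Asat va wb tx)) exprMn rmorphM/=.
rewrite (line_normE Aab va) (line_normE Aab wb) embM.
rewrite (nsq_theta_mul Aab Asat (is_line_dom wb) (fibre_emb W b) (fibre_emb W a)).
by rewrite tx mulrC.
Qed.

Lemma line_starK : involutive star.
Proof.
move=> v; have [s [a [x va]]] := line_ex v.
have := line_starP Aab Asat (line_starP Aab Asat va).
rewrite (thetaK Aab Asat (is_line_dom va)) => /(is_line_tag (fb_starK a)).
by move=> /line_uniq; apply.
Qed.

Lemma line_norm_star v : N (star v) = N v.
Proof.
have [s [a [x va]]] := line_ex v; apply: line_norm_inj (line_norm_ge0 v) _.
rewrite (line_normE Aab (line_starP Aab Asat va)) (line_normE Aab va) emb_star.
exact: (nsq_theta_star Aab Asat (is_line_dom va) (fibre_emb W a)).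
Qed.

Lemma line_star_mul v w : comp v w -> star (mul v w) = mul (star w) (star v).
Proof.
have [s [a [x va]]] := line_ex v; have [t [b [y wb]]] := line_ex w.
move=> /(line_compP va wb) tx.
have xs : Uopen (src s) (theta t y) by rewrite tx; exact: is_line_dom va.
have := line_starP Aab Asat (line_mulP Aab Asat va wb tx).
rewrite (thetaM Aab Asat (is_line_dom wb) xs) tx => /(is_line_tag (fb_star_mul a b)).
move=> /line_uniq; apply.
apply: (line_mulP Aab Asat (line_starP Aab Asat wb) (line_starP Aab Asat va)).
by rewrite (thetaK Aab Asat (is_line_dom va)) tx.
Qed.

Lemma line_star_comp v : comp (star v) v.
Proof.
have [s [a [x va]]] := line_ex v.
by apply/(line_compP (line_starP Aab Asat va) va).
Qed.

Lemma line_cstar v : N (mul (star v) v) = N v ^+ 2.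
Proof. by rewrite (line_normM (line_star_comp v)) line_norm_star expr2. Qed.

Lemma line_pos v : exists w,
  p w = germ_unit (germ_src (p v)) /\ mul (star v) v = mul (star w) w.
Proof.
have [s [a [x va]]] := line_ex v; have xs := is_line_dom va.
have [b bE] := fb_pos a.
have xss : Uopen (src (s^* * s)%g) x by rewrite -[(s^* * s)%g]/(val (src s)) src_idem.
have wb := mk_lineP b xss; exists (mk_line b xss); split.
  apply: (germ_uniq (line_projP Aab wb)).
  by rewrite (germ_srcE (line_projP Aab va)); exact: germ_unitP xs.
have := line_mulP Aab Asat (line_starP Aab Asat va) va erefl.
move=> /(is_line_tag bE) /line_uniq; apply.
exact: (line_mulP Aab Asat (line_starP Aab Asat wb) wb erefl).
Qed.

(** The squared distance from [b] to its projection on the line of [z] is the defect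
    in the Cauchy-Schwarz inequality, which is zero. *)
Lemma nsq_proj0 s x z b : fibre s z -> fibre s b -> nsq x z != 0 ->
  nsq x (b - (cval x (z^† ⋅ b) / nsq x z) *: z) = 0.
Proof.
move=> zs bs z0; set l := _ / _; rewrite -scaleNr (nsqDE x bs (fibreZ (- l) zs)).
rewrite (nsqZ x (- l) zs) csstarZ csmulZl csmulZr.
rewrite (cvalZ x (- l) (inCE_cross bs zs)) (cvalZ x (- l)^* (inCE_cross zs bs)).
have Nl : (- l)^* = - l^* by rewrite rmorphN.
rewrite (cval_cross_conj x zs bs) normrN Nl.
have zr := nsq_real x zs.
have lE : cval x (z^† ⋅ b) = l * nsq x z by rewrite divfK.
have bE : nsq x b * nsq x z = `|l| ^+ 2 * nsq x z * nsq x z.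
  rewrite mulrC -(nsq_cross Aab x zs bs) lE normrM exprMn -mulrA; congr (_ * _).
  by rewrite ger0_norm ?expr2//; exact: nsq_ge0 zs.
have {}bE := mulIf z0 bE.
have lEc : (cval x (z^† ⋅ b))^* = l^* * nsq x z by rewrite lE -[in RHS]zr -rmorphM.
rewrite lEc lE bE normCK.
by ring.
Qed.

Lemma line_scale_hat s (a : A s) v x : is_germ (p v) s x -> nsq x (emb a) != 0 ->
  exists k, v = sc k (hat a (p v)).
Proof.
move=> vs a0; have [b vb] := line_rep_at Aab vs.
have as' := fibre_emb W a; have bs := fibre_emb W b.
exists (cval x ((emb a)^† ⋅ emb b) / nsq x (emb a)).
set k := _ / _; have ka := line_scaleP Aab k (hatP a vs).
apply: (line_uniq (a := k *: a) (x := x)) ka.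
by apply/(is_line_same Aab _ vb); rewrite embZ; exact: (nsq_proj0 as' bs a0).
Qed.

Lemma line_scale_inj s (a : A s) x v k l : is_line v a x -> nsq x (emb a) != 0 ->
  sc k v = sc l v -> k = l.
Proof.
move=> va a0 kl; have := line_scaleP Aab k va.
rewrite kl => /(is_line_same Aab _ (line_scaleP Aab l va)).
rewrite !embZ -scalerBl (nsqZ _ _ (fibre_emb W a)) => /eqP.
by rewrite mulf_eq0 (negPf a0) orbF expf_eq0/= normr_eq0 subr_eq0 eq_sym => /eqP.
Qed.
End LineAlgebra.

(** * Continuity of the operations and local triviality *)

Lemma within_cvg (T : Type) (F : set_system T) (Y Z : topologicalType) (P : set Y)
    (phi : Y -> Z) (q : T -> Y) (y : Y) : Filter F ->
  {within P, continuous phi} -> P y -> q @ F --> y ->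
  (\forall i \near F, P (q i)) -> (fun i => phi (q i)) @ F --> phi y.
Proof.
move=> FF /subspace_continuousP phic Py qy qP V Vy.
have /qy qV := phic _ Py V Vy.
by apply: (@filterS2 _ F FF) qV qP => i /=; apply.
Qed.

Lemma within_proper (Y : topologicalType) (P : set Y) (y : Y) : P y ->
  ProperFilter (within P (nbhs y)).
Proof. by move=> Py; apply: Build_ProperFilter_ex => Q /nbhs_singleton Qy; exists y; exact: Qy. Qed.

Section LineContinuity.
Variables (R : realType) (S : invSemigroupType) (A : fellBundle R S).
Hypothesis Aab : semi_abelian A.
Hypothesis Asat : saturated A.
Variable W : envelopes A.
Variable tau : Topological (line W).
Hypothesis tauP : is_line_topology tau.
Local Notation X := (spectrum (CE W)).
Local Notation G := (germ W).
Local Notation L := (Topological.Pack tau).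
Local Notation emb := (@emb R S A W).
Local Notation Uopen := (@Uopen R S A W).
Local Notation theta := (@theta R S A W).
Local Notation K := (germ_groupoid W).
Local Notation D := (line_bundle W : bundle R L G).
Local Notation p := (@line_proj R S A W).
Local Notation comp v w := (composable K (p v) (p w)).
Local Notation sc := (@line_scale R S A W).
Local Notation ad := (@line_add R S A W).
Local Notation N := (@line_norm R S A W).
Local Notation mul := (@line_mul R S A W).
Local Notation star := (@line_star R S A W).
Implicit Types (r s t : S) (e : idem S) (x y : X) (g h : G) (u v w : L) (k : R[i]).

Let usc : is_usc_banach_bundle D. Proof. by have [[]] := tauP. Qed.
Let normc : continuous (N : L -> R). Proof. by have [[]] := tauP. Qed.
Let projc : continuous (p : L -> G). Proof. exact: bb_proj_continuous usc. Qed.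

Lemma line_normD v w : p v = p w -> N (ad v w) <= N v + N w.
Proof.
move=> vw; have [V [phi H]] := bb_fiber usc (p w).
have [v' v'E] := fiber_surj H vw; have [w' w'E] := fiber_surj H (erefl (p w)).
have HN (u : V) : (N (phi u))%:C%C = `|u| := fiber_norm H u.
have HA : phi (v' + w') = ad v w by rewrite (fiber_add H) v'E w'E.
by rewrite -lecR rmorphD/= -HA -v'E -w'E !HN ler_normD.
Qed.

Lemma line_normZ k v : (N (sc k v))%:C%C = `|k| * (N v)%:C%C.
Proof.
have [V [phi H]] := bb_fiber usc (p v).
have [v' v'E] := fiber_surj H (erefl (p v)).
have HN (u : V) : (N (phi u))%:C%C = `|u| := fiber_norm H u.
have HZ : phi (k *: v') = sc k v by rewrite (fiber_scale H) v'E.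
by rewrite -HZ -v'E !HN normrZ.
Qed.

Lemma line_normZ_real k v : N (sc k v) = complex.Re `|k| * N v.
Proof. by apply: complexI; rewrite line_normZ rmorphM/= Re_normE. Qed.

Lemma line_norm_zero g : N (line_zero g) = 0.
Proof.
have [V [phi H]] := bb_fiber usc g; apply: complexI.
have H0 : phi 0 = line_zero g := fiber_zero H.
have HN : (N (phi 0))%:C%C = `|0 : V| := fiber_norm H 0.
by rewrite -H0 HN normr0.
Qed.

Definition line_sub v u : L := ad v (sc (-1) u).

Lemma line_subP v u s (a b : A s) x : is_line v a x -> is_line u b x ->
  is_line (line_sub v u) (a - b) x.
Proof.
by move=> va ub; rewrite -(scaleN1r b); apply: line_addP => //; exact: line_scaleP.
Qed.

Lemma line_rep_common v u : p v = p u ->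
  exists s (a b : A s) x, is_line v a x /\ is_line u b x.
Proof.
move=> vu; have [s [b [x ub]]] := line_ex u.
by have [a va] := line_rep_fibre Aab vu ub; exists s, a, b, x.
Qed.

Lemma line_sub_proj v u : p v = p u -> p (line_sub v u) = p v.
Proof.
move=> /line_rep_common[s [a [b [x [va ub]]]]].
by apply: (germ_uniq (line_projP Aab (line_subP va ub))); exact: line_projP va.
Qed.

Lemma line_subK v u : p v = p u -> ad (line_sub v u) u = v.
Proof.
move=> /line_rep_common[s [a [b [x [va ub]]]]].
have := line_addP Aab (line_subP va ub) ub.
by rewrite subrK => /line_uniq; apply.
Qed.

Lemma line_subvv v : line_sub v v = line_zero (p v).
Proof.
have [s [a [x va]]] := line_ex v; have := line_subP va va.
by rewrite subrr => /line_uniq; apply; apply: line_zeroP => //; exact: line_projP va.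
Qed.

Lemma line_add0v v : ad (line_zero (p v)) v = v.
Proof. by rewrite -line_subvv line_subK. Qed.

Lemma hat_proj s (a : A s) g x : is_germ g s x -> p (hat a g) = g.
Proof.
by move=> gs; apply: (germ_uniq (line_projP Aab (hatP a gs)) gs).
Qed.

Section Sections.
Variables (T : Type) (F : set_system T).
Context {FF : ProperFilter F}.
Implicit Types (f : T -> L).

Lemma germ_near_proj f g s x : is_germ g s x -> (p \o f) @ F --> g ->
  \forall i \near F, is_germ (p (f i)) s (germ_src (p (f i))).
Proof. by move=> gs /(germ_cvg _ _ gs)[]. Qed.

Lemma add_cvg f f' v w : f @ F --> v -> f' @ F --> w -> p v = p w ->
  (\forall i \near F, p (f i) = p (f' i)) ->
  ((fun i => ad (f i) (f' i) : L) @ F) --> (ad v w : L).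
Proof.
move=> fv f'w vw pff'.
apply: (within_cvg (q := fun i => (f i, f' i)) (y := (v, w)) _ (bb_add_continuous usc)) => //.
exact: cvg_pair fv f'w.
Qed.

Lemma hat_cvg s (a : A s) g x (gamma : T -> G) : is_germ g s x -> gamma @ F --> g ->
  ((fun i => hat a (gamma i) : L) @ F) --> (hat a g : L).
Proof.
move=> gs gF; have [_ /(_ s a) hc] := tauP.
have [sF _] := (germ_cvg _ _ gs).1 gF.
apply: (within_cvg _ hc) gF _; first by exists x => //; exact: is_germ_dom gs.
by apply: filterS sF => i si; exists (germ_src (gamma i)) => //; exact: is_germ_dom si.
Qed.

(** The difference of the net and of the section along its base points converges to
    zero, and the net is recovered from it by adding the section back. *)
Lemma cvg_hat f s (a : A s) g x : is_germ g s x -> (p \o f) @ F --> g ->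
  (fun i => N (line_sub (f i) (hat a (p (f i))))) @ F --> (0 : R) ->
  f @ F --> (hat a g : L).
Proof.
move=> gs fg dN; have sF := germ_near_proj gs fg.
have hF := hat_cvg (a:=a) gs fg.
pose d i : L := line_sub (f i) (hat a (p (f i))).
have pd : \forall i \near F, p (d i) = p (f i).
  by apply: filterS sF => i si; rewrite line_sub_proj ?(hat_proj a si).
have dF : d @ F --> (line_zero g : L).
  have pdF : (fun i => p (d i)) @ F --> g.
    by apply: cvg_trans fg; apply: near_eq_cvg; apply: filterS pd => i /= ->.
  exact: (bb_cvg_zero usc (F := d @ F) _ pdF).
have := @add_cvg d (fun i => hat a (p (f i))) _ _ dF hF.
rewrite -{1}(hat_proj a gs) -line_subvv line_sub_proj // => /(_ erefl).
have -> : ad (line_zero g) (hat a g) = hat a g.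
  by rewrite -{1}(hat_proj a gs) line_add0v.
move=> H.
apply: cvg_trans (H _).
  apply: near_eq_cvg; apply: filterS sF => i si.
  by rewrite /d line_subK // (hat_proj a si).
by apply: filterS2 sF pd => i si ->; rewrite (hat_proj a si).
Qed.

Lemma hat_cvgP f v s (a : A s) x : is_line v a x -> f @ F --> v ->
  [/\ (p \o f) @ F --> p v,
      \forall i \near F, is_germ (p (f i)) s (germ_src (p (f i))) &
      (fun i => N (line_sub (f i) (hat a (p (f i))))) @ F --> (0 : R)].
Proof.
move=> va fv; have gs := line_projP Aab va.
have pf : (p \o f) @ F --> p v by exact: (cvg_comp _ _ fv (projc (x := v))).
have sF := germ_near_proj gs pf; split=> //.
have hv : hat a (p v) = v by apply: line_uniq (hatP a gs) va.
have := hat_cvg (a:=a) gs pf; rewrite hv => hF.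
have shF := cvg_comp _ _ hF (bb_scale_continuous usc (k := -1) (x := v)).
have dF : (fun i => line_sub (f i) (hat a (p (f i)))) @ F --> line_sub v v.
  apply: add_cvg fv shF _ _.
    have := line_scaleP Aab (-1) va => /(line_projP Aab).
    exact: germ_uniq gs.
  apply: filterS sF => i si.
  apply: (germ_uniq si); apply: line_projP => //.
  by apply: line_scaleP => //; exact: hatP.
have := cvg_comp _ _ dF (normc (x := line_sub v v)).
by rewrite line_subvv line_norm_zero.
Qed.
End Sections.

(** The difference of [v w] and [(hat a) (hat b)] is split as
    [(v - hat a) w + (hat a) (w - hat b)]. *)
Lemma line_mul_error v w s (a : A s) t (b : A t) x y :
  is_germ (p v) s x -> is_germ (p w) t y -> theta t y = x ->
  N (line_sub (mul v w) (hat (fb_mul a b) (p (mul v w)))) <=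
  N (line_sub v (hat a (p v))) * N w + N (hat a (p v)) * N (line_sub w (hat b (p w))).
Proof.
move=> gs ht tx; have [a' va] := line_rep_at Aab gs; have [b' wb] := line_rep_at Aab ht.
have ha := hatP a gs; have hb := hatP b ht.
have vw := line_mulP Aab Asat va wb tx.
have da := line_subP va ha; have db := line_subP wb hb.
have m1 := line_mulP Aab Asat da wb tx; have m2 := line_mulP Aab Asat ha db tx.
have pvw := line_projP Aab vw.
have c1 : comp (line_sub v (hat a (p v))) w by apply/(line_compP Aab Asat da wb).
have c2 : comp (hat a (p v)) (line_sub w (hat b (p w))) by apply/(line_compP Aab Asat ha db).
rewrite -(line_normM Aab Asat c1) -(line_normM Aab Asat c2).
have -> : line_sub (mul v w) (hat (fb_mul a b) (p (mul v w))) =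
    ad (mul (line_sub v (hat a (p v))) w) (mul (hat a (p v)) (line_sub w (hat b (p w)))).
  have := line_subP vw (hatP (fb_mul a b) pvw).
  have -> : fb_mul a' b' - fb_mul a b = fb_mul (a' - a) b' + fb_mul a (b' - b).
    have l1 := linear_funB (@fb_mul_linl _ _ A s t b') a' a.
    have l2 := linear_funB (@fb_mul_linr _ _ A s t a) b' b.
    by rewrite l1 l2 addrA subrK.
  by move=> /line_uniq; apply; exact: line_addP.
by apply: line_normD; apply: (germ_uniq (line_projP Aab m1)); exact: line_projP m2.
Qed.

Lemma line_mul_continuous : {within [set q : L * L | comp q.1 q.2],
  continuous (fun q : L * L => mul q.1 q.2 : L)}.
Proof.
apply/subspace_continuousP => -[v w] /= vwc.
have [s [a [x va]]] := line_ex v; have [t [b [y wb]]] := line_ex w.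
have tx := (line_compP Aab Asat va wb).1 vwc.
have gs := line_projP Aab va; have ht := line_projP Aab wb.
have FF := @within_proper _ [set q : L * L | comp q.1 q.2] (v, w) vwc.
set F := within _ _ in FF *.
have FF' : Filter F by exact: filter_filter.
have vF : (fun q : L * L => q.1) @ F --> v.
  by apply: cvg_trans (@cvg_fst _ _ (nbhs v) (nbhs w) _); exact: cvg_within_filter.
have wF : (fun q : L * L => q.2) @ F --> w.
  by apply: cvg_trans (@cvg_snd _ _ (nbhs v) (nbhs w) _); exact: cvg_within_filter.
have [pvF svF nvF] := hat_cvgP va vF; have [pwF swF nwF] := hat_cvgP wb wF.
have cF : \forall q \near F, comp q.1 q.2 by exact: withinT.
have vw := line_mulP Aab Asat va wb tx; have gvw := line_projP Aab vw.
suff : (fun q : L * L => mul q.1 q.2 : L) @ F --> (hat (fb_mul a b) (p (mul v w)) : L).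
  by rewrite (line_uniq (hatP (fb_mul a b) gvw) vw); exact.
have pmF : (fun q : L * L => p (mul q.1 q.2)) @ F --> p (mul v w).
  rewrite line_mul_proj//.
  have etale := germ_is_etale Aab Asat W.
  have := within_cvg (q := fun q : L * L => (p q.1, p q.2)) (y := (p v, p w)) _ (etale_mul etale)
    vwc (cvg_pair pvF pwF) cF.
  move=> /(_ FF' FF' (nbhs_filter _) (nbhs_filter _)).
  apply: cvg_trans; apply: near_eq_cvg; apply: filterS cF => q qc.
  by rewrite line_mul_proj.
apply: (cvg_hat gvw pmF).
have nw : (fun q : L * L => N q.2) @ F --> N w by exact: (cvg_comp _ _ wF (normc (x := w))).
have nh : (fun q : L * L => N (hat a (p q.1))) @ F --> N (hat a (p v)).
  exact: (cvg_comp _ _ (hat_cvg (a := a) gs pvF) (normc (x := hat a (p v)))).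
have bd := cvgD (cvgM nvF nw) (cvgM nh nwF).
rewrite mul0r mulr0 addr0 in bd; have {}bd := bd FF' FF' FF'.
refine (squeeze_cvgr _ (cvg_cst (0 : R)) bd).
apply: filterS3 svF swF cF => q sq tq qc; rewrite line_norm_ge0/=.
have [a' va'] := line_rep_at Aab sq; have [b' wb'] := line_rep_at Aab tq.
exact: (line_mul_error _ _ sq tq ((line_compP Aab Asat va' wb').1 qc)).
Qed.

Lemma line_star_continuous : continuous (star : L -> L).
Proof.
move=> v; have [s [a [x va]]] := line_ex v; have sv := line_starP Aab Asat va.
have [pF sF nF] := @hat_cvgP _ (nbhs v) _ id v s a x va (fun P => id).
have gs := line_projP Aab sv.
suff : star @ v --> (hat (fb_star a) (p (star v)) : L).
  by rewrite (line_uniq (hatP (fb_star a) gs) sv); exact.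
have psF : (fun u => p (star u)) @ v --> p (star v).
  have -> : (fun u => p (star u)) = @germ_inv R S A W \o p.
    by apply/funext => u; rewrite /= line_star_proj.
  rewrite line_star_proj//; apply: (cvg_comp _ _ pF).
  exact: germ_inv_continuous.
apply: (cvg_hat gs psF); apply: cvg_trans nF; apply: near_eq_cvg.
apply: filterS sF => u su; have [b ub] := line_rep_at Aab su.
have us := line_starP Aab Asat ub.
rewrite -(line_norm_star Aab Asat (line_sub _ _)); congr N.
have := line_starP Aab Asat (line_subP ub (hatP a su)).
have -> : fb_star (b - a) = fb_star b - fb_star a.
  have := fb_star_lin (-1) a b.
  by rewrite rmorphN1 !scaleN1r addrC => ->; rewrite addrC.
move=> /line_uniq; apply; apply: (line_subP us).
by apply: hatP; exact: line_projP us.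
Qed.

Lemma germ_dom_elt g : exists s (a : A s) x, is_germ g s x /\ nsq x (emb a) != 0.
Proof.
have [s [x gs]] := germ_ex g.
have [_ [a <-] a0] := (Uopen_srcP Aab Asat s x).1 (is_germ_dom gs).
by exists s, a, x.
Qed.

Lemma line_one_dimensional : one_dimensional D.
Proof.
move=> g; have [s [a [x [gs a0]]]] := germ_dom_elt g.
have ha := hatP a gs; exists (hat a g); split=> [||v /= vg].
- exact: hat_proj gs.
- move=> /= h0; have := line_normE Aab ha; rewrite h0 line_norm_zero expr0n/=.
  by move=> z; move: a0; rewrite -z eqxx.
- rewrite -vg; apply: (line_scale_hat Aab _ a0); by rewrite vg.
Qed.

Lemma line_norm_sub_hat s (a : A s) g x k l : is_germ g s x ->
  N (line_sub (sc k (hat a g)) (hat (l *: a) g)) = complex.Re `|k - l| * N (hat a g).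
Proof.
move=> gs; rewrite -line_normZ_real; congr N; have ha := hatP a gs.
have := line_subP (line_scaleP Aab k ha) (hatP (l *: a) gs).
by rewrite -scalerBl => /line_uniq; apply; exact: line_scaleP.
Qed.

(** Over the germs [[s, y]] at which [a] does not vanish, the section [hat a] spans
    the fibres; [psi] is the coefficient of an element with respect to it. *)
Lemma line_locally_trivial : locally_trivial D.
Proof.
move=> g; have [s [a [x [gs a0]]]] := germ_dom_elt g.
pose V := [set y : X | nsq y (emb a) != 0].
have Vop : open V.
  by apply: cval_neq0_open; exact: (inCE_cross (fibre_emb W a) (fibre_emb W a)).
have Vs : V `<=` Uopen (src s).
  by move=> y ya; apply/(Uopen_srcP Aab Asat); exists (emb a) => //; exact: fibre_emb.
pose O : set G := germ_open s V.
have Oop : open O by exact: germ_open_open.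
have OP z : O z -> exists y, is_germ z s y /\ nsq y (emb a) != 0.
  by move=> [y Vy zs]; exists y.
exists O; split=> //; first by exists x.
pose phi (q : G * R[i]^o) : L := sc q.2 (hat a q.1).
pose psi (v : L) : R[i]^o := xget 0 [set k | v = sc k (hat a (p v))].
have psiP v : O (p v) -> v = sc (psi v) (hat a (p v)).
  move=> /OP[y [vs ya]]; have [k vk] := line_scale_hat Aab vs ya.
  by rewrite {1}/psi; case: xgetP => [l _ //|/(_ k)].
have phi_proj z k : O z -> p (phi (z, k)) = z.
  move=> /OP[y [zs _]]; apply: (germ_uniq _ zs).
  by apply: line_projP => //; apply: line_scaleP => //; exact: hatP.
have phi_inj z k l : O z -> phi (z, k) = phi (z, l) -> k = l.
  by move=> /OP[y [zs ya]]; exact: (line_scale_inj Aab (hatP a zs) ya).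
exists phi, psi; split=> //.
- move=> z k c d /OP[y [zs _]]; have hz := hatP a zs.
  have L1 := line_scaleP Aab (k * c + d) hz; apply: line_uniq L1 _.
  rewrite scalerDl -scalerA; apply: line_addP => //; last exact: line_scaleP.
  by apply: line_scaleP => //; exact: line_scaleP.
- split=> [z k Oz|v Ov]; last by rewrite [RHS]psiP.
  have := psiP (phi (z, k)); rewrite phi_proj// => /(_ Oz) H.
  exact: (phi_inj z) (esym H).
- apply/subspace_continuousP => -[z k] /= [Oz _].
  have FF := @within_proper _ (O `*` setT) (z, k) (conj Oz I).
  set F := within _ _ in FF *.
have FF' : Filter F by exact: filter_filter.
  have zF : (fun q : G * R[i]^o => q.1) @ F --> z.
    apply: cvg_trans (@cvg_fst _ _ (nbhs z) (nbhs (k : R[i]^o)) _).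
    exact: cvg_within_filter.
  have kF : (fun q : G * R[i]^o => q.2) @ F --> (k : R[i]^o).
    apply: cvg_trans (@cvg_snd _ _ (nbhs z) (nbhs (k : R[i]^o)) _).
    exact: cvg_within_filter.
  have OF : \forall q \near F, O q.1.
    have : \forall q \near F, (O `*` setT) q by exact: withinT.
    by apply: filterS => q [].
  have [y [zs ya]] := OP _ Oz.
  have phiE : phi (z, k) = hat (k *: a) z.
    by apply: line_uniq (hatP (k *: a) zs); apply: line_scaleP => //; exact: hatP.
  suff : phi @ F --> (hat (k *: a) z : L) by rewrite -phiE; exact.
  have pF : (p \o phi) @ F --> z.
    apply: cvg_trans zF; apply: near_eq_cvg; apply: filterS OF => -[z' k'] Oz' /=.
    by rewrite phi_proj.
  apply: (cvg_hat zs pF).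
  have nh : (fun q : G * R[i]^o => N (hat a q.1)) @ F --> N (hat a z).
    exact: (cvg_comp _ _ (hat_cvg (a := a) zs zF) (normc (x := hat a z))).
  have := cvgM ((cvg_Re_norm _ _ _).1 kF) nh; rewrite mul0r => /(_ FF' FF').
  apply: cvg_trans; apply: near_eq_cvg; apply: filterS OF => -[z' k'] /= Oz'.
  have [y' [zs' _]] := OP _ Oz'.
  by rewrite phi_proj// /phi/= (line_norm_sub_hat _ _ _ zs').
- apply/subspace_continuousP => v /= Ov.
  have FF := @within_proper L (p @^-1` O) v Ov.
  set F := within _ _ in FF *.
have FF' : Filter F by exact: filter_filter.
  have vF : id @ F --> v by exact: cvg_within_filter.
  have OF : \forall w \near F, O (p w) by exact: withinT.
  have [y [vs ya]] := OP _ Ov; set k := psi v.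
  have vk : is_line v (k *: a) y.
    by rewrite (psiP _ Ov); apply: line_scaleP => //; exact: hatP.
  have [pF _ nF] := hat_cvgP vk vF.
  have nh : (fun w => N (hat a (p w))) @ F --> N (hat a (p v)).
    exact: (cvg_comp _ _ (hat_cvg (a := a) vs pF) (normc (x := hat a (p v)))).
  have hn z y' : is_germ z s y' -> nsq y' (emb a) != 0 -> N (hat a z) != 0.
    move=> zs; apply: contra => /eqP h0.
    by rewrite -(line_normE Aab (hatP a zs)) h0 expr0n.
  suff : psi @ F --> (k : R[i]^o) by exact.
  apply/cvg_Re_norm.
  have := cvgM nF (cvgV (hn _ _ vs ya) nh); rewrite mul0r => /(_ FF' FF').
  apply: cvg_trans; apply: near_eq_cvg; apply: filterS OF => w Ow.
  have [y' [ws wa]] := OP _ Ow.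
  have E := line_norm_sub_hat a (psi w) k ws; rewrite -(psiP _ Ow) in E.
  rewrite -[LHS]/(N (line_sub w (hat (k *: a) (p w))) / N (hat a (p w))) E.
  by rewrite mulfK// (hn _ _ ws wa).
Qed.
End LineContinuity.

Theorem theorem3p29 (R : realType) (S : invSemigroupType) (A : fellBundle R S)
    (Asat : saturated A) (Aab : semi_abelian A) (W : envelopes A)
    (tau : Topological (line W)) (tauP : is_line_topology tau) :
  is_fell_line_bundle (germ_groupoid W)
    (line_bundle W : bundle R (Topological.Pack tau) (germ W))
    (@line_mul R S A W) (@line_star R S A W).
Proof.
have [cbb _] := tauP; split=> //; last 2 first.
- exact: line_one_dimensional.
- exact: line_locally_trivial.
split.
- exact: germ_is_etale.
- exact: cbb_usc cbb.
- exact: line_mul_proj.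
- exact: line_mul_continuous.
- exact: line_mulA.
- exact: line_mul_linl.
- exact: line_mul_linr.
- exact: line_star_proj.
- exact: line_star_continuous.
- exact: line_star_lin.
- by move=> v w vw; have := line_normM Aab Asat vw; rewrite /= => ->.
- exact: line_starK.
- exact: line_norm_star.
- exact: line_star_mul.
- exact: line_cstar.
- exact: line_pos.
Qed.
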